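(* Let $Q$ be a Dynkin quiver with vertex set $Q_0=\{1,\ldots,n\}$ and let $\Lambda$ be the preprojective algebra of $Q$. Then $I_i$ is a basic support $\tau$-tilting ideal of $\Lambda$ for any $i\in Q_0$.
   Context: $K$ is an algebraically closed field. A Dynkin quiver is a finite quiver whose underlying graph is of type $A_n$ ($n\ge1$), $D_n$ ($n\ge4$) or $E_6,E_7,E_8$. The double quiver $\overline{Q}$ is obtained from $Q$ by adding for each arrow $a:i\to j$ in $Q_1$ an arrow $a^*:j\to i$. The preprojective algebra is $\Lambda=K\overline{Q}/\langle\sum_{a\in Q_1}(aa^*-a^*a)\rangle$, a finite-dimensional selfinjective algebra. $e_i$ is the primitive idempotent at the vertex $i$ and $I_i:=\Lambda(1-e_i)\Lambda$. For a finite-dimensional algebra $A$ with Auslander–Reiten translation $\tau$, let $|X|$ denote the number of pairwise non-isomorphic indecomposable direct summands of $X$. $X$ is $\tau$-rigid if $\mathrm{Hom}_A(X,\tau X)=0$; $\tau$-tilting if moreover $|X|=|A|$; support $\tau$-tilting if it is a $\tau$-tilting $(A/\langle e\rangle)$-module for some idempotent $e$ of $A$ (the zero module is support $\tau$-tilting, with $e=1$). A two-sided ideal $I$ of $\Lambda$ is called support $\tau$-tilting if $I$ is support $\tau$-tilting both as a left $\Lambda$-module and as a right $\Lambda$-module; it is basic if it is basic as a module. *)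

(* Defs.v *)
From HB Require Import structures.
From mathcomp Require Import all_boot all_algebra.
From mathcomp Require Import finmap monalg boolp.

Set Implicit Arguments.
Unset Strict Implicit.
Unset Printing Implicit Defensive.

Import GRing.Theory.
Local Open Scope ring_scope.
Local Open Scope quotient_scope.
Import Quotient.

(* Algebras over K, presented by their structure map K -> Z(A).  [pzRingType]
   rather than [algType] because A/AeA is the zero ring when e = 1. *)
Record algebra (K : fieldType) := Algebra {
  alg_ring :> pzRingType;
  alg_scalar : {rmorphism K -> alg_ring};
  alg_central : forall (c : K) (x : alg_ring),
    alg_scalar c * x = x * alg_scalar c
}.

Section Opposite.
Variables (K : fieldType) (A : algebra K).

Definition op_scalar : K -> (A : pzRingType)^c := @alg_scalar K A.

Fact op_scalar_zmod : zmod_morphism op_scalar.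
Proof. exact: (raddfB (@alg_scalar K A)). Qed.

Fact op_scalar_monoid : monoid_morphism op_scalar.
Proof.
split; first exact: (rmorph1 (@alg_scalar K A)).
by move=> x y; rewrite mulrC; apply: (rmorphM (@alg_scalar K A)).
Qed.

HB.instance Definition _ :=
  GRing.isZmodMorphism.Build K (A : pzRingType)^c op_scalar op_scalar_zmod.
HB.instance Definition _ :=
  GRing.isMonoidMorphism.Build K (A : pzRingType)^c op_scalar op_scalar_monoid.

Fact op_central (c : K) (x : (A : pzRingType)^c) :
  op_scalar c * x = x * op_scalar c.
Proof. exact/esym/alg_central. Qed.

(* Right A-modules are left modules over [op A]: [a *: m] stands for m.a *)
Definition op : algebra K := Algebra op_central.

End Opposite.

Section Ideals.
Variable A : pzRingType.

Record ideal := Ideal {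
  ideal_mem :> {pred A};
  ideal_zmod : zmod_closed ideal_mem;
  ideal_mull : forall a x : A, x \in ideal_mem -> a * x \in ideal_mem;
  ideal_mulr : forall a x : A, x \in ideal_mem -> x * a \in ideal_mem
}.

HB.instance Definition _ (I : ideal) :=
  GRing.isZmodClosed.Build A (ideal_mem I) (ideal_zmod I).

(* The two-sided ideal AzA *)
Section Principal.
Variable z : A.

Definition principal_mem : {pred A} := fun x =>
  `[< exists m (a b : 'I_m -> A), x = \sum_k a k * z * b k >].

Fact principal_zmod : zmod_closed principal_mem.
Proof.
split=> [|x y /asboolP[m [a [b ->]]] /asboolP[p [c [d ->]]]]; apply/asboolP.
  by exists 0%N, (fun=> 0), (fun=> 0); rewrite big_ord0.
exists (m + p)%N,
  (fun k => match split k with inl i => a i | inr j => - c j end),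
  (fun k => match split k with inl i => b i | inr j => d j end).
rewrite big_split_ord /= -sumrN; congr (_ + _); apply: eq_bigr => k _.
  by rewrite (unsplitK (inl k)).
by rewrite (unsplitK (inr k)) !mulNr.
Qed.

Fact principal_mull (a x : A) : x \in principal_mem -> a * x \in principal_mem.
Proof.
case/asboolP=> m [c [d ->]]; apply/asboolP.
exists m, (fun k => a * c k), d; rewrite mulr_sumr.
by apply: eq_bigr => k _; rewrite !mulrA.
Qed.

Fact principal_mulr (a x : A) : x \in principal_mem -> x * a \in principal_mem.
Proof.
case/asboolP=> m [c [d ->]]; apply/asboolP.
exists m, c, (fun k => d k * a); rewrite mulr_suml.
by apply: eq_bigr => k _; rewrite !mulrA.
Qed.

Definition principal_ideal : ideal :=
  Ideal principal_zmod principal_mull principal_mulr.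
End Principal.

End Ideals.

Section IdealModules.
Variables (A : pzRingType) (I : ideal A).

Fact op_ideal_zmod : zmod_closed (I : {pred A^c}).
Proof. exact: (ideal_zmod I). Qed.

Definition op_ideal : ideal A^c :=
  @Ideal A^c I op_ideal_zmod (@ideal_mulr A I) (@ideal_mull A I).

Definition ideal_module := {x : A^o | x \in I}.
HB.instance Definition _ := SubChoice.on ideal_module.

Fact ideal_module_closed : subsemimod_closed (I : {pred A^o}).
Proof.
split; last by move=> a x; apply: ideal_mull.
by split=> [|x y]; [apply: (@rpred0 A I) | apply: (@rpredD A I)].
Qed.

HB.instance Definition _ := GRing.SubChoice_isSubLmodule.Build A A^o
  (fun x => x \in I) ideal_module ideal_module_closed.

End IdealModules.

Section QuotientRing.
Variables (A : pzRingType) (I : ideal A).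

Definition quotient_ring := Quotient.quot I.
Local Notation Q := quotient_ring.

HB.instance Definition _ := GRing.Zmodule.on Q.
HB.instance Definition _ : EqQuotient A (Quotient.equiv I) Q :=
  EqQuotient.on Q.
HB.instance Definition _ : @isZmodQuotient A (Quotient.equiv I) 0 -%R +%R Q :=
  isZmodQuotient.Build A (Quotient.equiv I) 0 -%R +%R Q
    (lock _) (@Quotient.pi_opp A I) (@Quotient.pi_add A I).

Definition quotient_one : Q := lift_cst Q 1.
Definition quotient_mul := lift_op2 Q *%R.

Canonical pi_quotient_one_morph := PiConst quotient_one.

Fact pi_quotient_mul : {morph \pi : x y / x * y >-> quotient_mul x y}.
Proof.
move=> x y; unlock quotient_mul; apply/eqP; rewrite piE Quotient.equivE.
rewrite -[_ * _](addrNK (x * repr (\pi_Q y))) -mulrBr.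
rewrite -addrA -mulrBl rpredD //.
  by rewrite ideal_mull // Quotient.idealrDE opprK reprK.
by rewrite ideal_mulr // Quotient.idealrDE opprK reprK.
Qed.
Canonical pi_quotient_mul_morph := PiMorph2 pi_quotient_mul.

Fact quotient_mulA : associative quotient_mul.
Proof. by move=> x y z; rewrite -[x]reprK -[y]reprK -[z]reprK !piE mulrA. Qed.

Fact quotient_mul1r : left_id quotient_one quotient_mul.
Proof. by move=> x; rewrite -[x]reprK !piE mul1r. Qed.

Fact quotient_mulr1 : right_id quotient_one quotient_mul.
Proof. by move=> x; rewrite -[x]reprK !piE mulr1. Qed.

Fact quotient_mulDl : left_distributive quotient_mul +%R.
Proof.
move=> x y z; rewrite -[x]reprK -[y]reprK -[z]reprK.
by apply/eqP; rewrite piE /= mulrDl equiv_refl.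
Qed.

Fact quotient_mulDr : right_distributive quotient_mul +%R.
Proof.
move=> x y z; rewrite -[x]reprK -[y]reprK -[z]reprK.
by apply/eqP; rewrite piE /= mulrDr equiv_refl.
Qed.

HB.instance Definition _ := GRing.Zmodule_isPzRing.Build Q quotient_mulA
  quotient_mul1r quotient_mulr1 quotient_mulDl quotient_mulDr.

Definition quotient_map (x : A) : Q := \pi_Q x.

Fact quotient_map_zmod : zmod_morphism quotient_map.
Proof. by move=> x y; rewrite /quotient_map !piE. Qed.

Fact quotient_map_monoid : monoid_morphism quotient_map.
Proof.
split; first by rewrite /quotient_map; apply/esym; rewrite [1]piE.
by move=> x y; apply: pi_quotient_mul.
Qed.

HB.instance Definition _ :=
  GRing.isZmodMorphism.Build A Q quotient_map quotient_map_zmod.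
HB.instance Definition _ :=
  GRing.isMonoidMorphism.Build A Q quotient_map quotient_map_monoid.

End QuotientRing.

Section QuotientAlgebra.
Variables (K : fieldType) (A : algebra K) (I : ideal A).

Fact quotient_central (c : K) (x : quotient_ring I) :
  (@quotient_map A I \o @alg_scalar K A) c * x =
  x * (@quotient_map A I \o @alg_scalar K A) c.
Proof.
have -> : x = quotient_map I (repr x) by rewrite /quotient_map reprK.
by rewrite /= -!rmorphM alg_central.
Qed.

Definition quotient_algebra : algebra K := Algebra quotient_central.
End QuotientAlgebra.

Record quiver (V : finType) := Quiver {
  arrow : finType;
  src : arrow -> V;
  tgt : arrow -> V
}.

Section PathAlgebra.
Variables (K : fieldType) (V : finType) (Q : quiver V).

Fixpoint walk (v : V) (s : seq (arrow Q)) : bool :=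
  if s is a :: s' then (src a == v) && walk (tgt a) s' else true.

Definition walk_end (v : V) (s : seq (arrow Q)) : V := last v (map (@tgt V Q) s).

(* A path is its source together with its arrows in order of traversal; the
   product pq of paths means first p, then q. *)
Definition qpath := {p : V * seq (arrow Q) | walk p.1 p.2}.
HB.instance Definition _ := Choice.on qpath.

Definition path_src (p : qpath) : V := (val p).1.
Definition path_arrows (p : qpath) : seq (arrow Q) := (val p).2.
Definition path_tgt (p : qpath) : V := walk_end (path_src p) (path_arrows p).

Fact walk_arrow (a : arrow Q) : walk (src a) [:: a].
Proof. by rewrite /= eqxx. Qed.

Definition trivial_path (v : V) : qpath := exist _ (v, [::]) isT.
Definition arrow_path (a : arrow Q) : qpath :=
  exist _ (src a, [:: a]) (walk_arrow a).

Fact walk_cat v s1 s2 :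
  walk v (s1 ++ s2) = walk v s1 && walk (walk_end v s1) s2.
Proof. by elim: s1 v => //= a s IHs v; rewrite IHs andbA. Qed.

(* [insub] yields [Some] here, see [path_catE] *)
Definition path_cat (p q : qpath) : option qpath :=
  if path_tgt p == path_src q
  then (insub (path_src p, path_arrows p ++ path_arrows q) : option qpath)
  else None.

Fact path_catE p q : omap val (path_cat p q) =
  if path_tgt p == path_src q
  then Some (path_src p, path_arrows p ++ path_arrows q) else None.
Proof.
rewrite /path_cat; case: eqP => //= e; rewrite insubT //= walk_cat.
rewrite -[walk_end _ _]/(path_tgt p) e.
by rewrite (valP p : walk (path_src p) _) (valP q : walk (path_src q) _).
Qed.

Fact path_catP p q r : path_cat p q = Some r <->
  path_tgt p = path_src q /\
  val r = (path_src p, path_arrows p ++ path_arrows q).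
Proof.
have := path_catE p q; case: (path_cat p q) => [s|] /=; case: eqP => // e.
  case=> es; split=> [[<-]//|[_ er]]; congr Some; apply: val_inj.
  by rewrite /= es; apply/esym/er.
by move=> _; split=> // -[].
Qed.

Fact path_cat_src p q r : path_cat p q = Some r -> path_src r = path_src p.
Proof. by case/path_catP=> _; rewrite /path_src => ->. Qed.

Fact path_cat_tgt p q r : path_cat p q = Some r -> path_tgt r = path_tgt q.
Proof.
case/path_catP=> e er; rewrite /path_tgt /path_src /path_arrows er /=.
rewrite /walk_end map_cat last_cat.
by rewrite -[last (val p).1 _]/(path_tgt p) e.
Qed.

Fact path_cat_trivl p v :
  path_cat (trivial_path v) p = if v == path_src p then Some p else None.
Proof.
case: eqP => [e|ne]; last by rewrite /path_cat; case: eqP.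
apply/path_catP; split=> //; rewrite e.
by rewrite /path_src /path_arrows; case: (val p).
Qed.

Fact path_cat_trivr p v :
  path_cat p (trivial_path v) = if path_tgt p == v then Some p else None.
Proof.
case: eqP => [e|ne]; last by rewrite /path_cat; case: eqP.
apply/path_catP; split=> //; rewrite cats0.
by rewrite /path_src /path_arrows; case: (val p).
Qed.

Fact path_catA p q r :
  obind (path_cat p) (path_cat q r) = obind (path_cat^~ r) (path_cat p q).
Proof.
case eqr: (path_cat q r) => [s|] /=; case epq: (path_cat p q) => [t|] //=.
- have [e1 v1] := (path_catP _ _ _).1 eqr.
  have [e2 v2] := (path_catP _ _ _).1 epq.
  apply: (inj_omap val_inj); rewrite !path_catE.
  rewrite (path_cat_src eqr) (path_cat_tgt epq) e1 e2 !eqxx.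
  by rewrite /path_src /path_arrows v1 v2 /= catA.
- apply: (inj_omap val_inj); rewrite path_catE (path_cat_src eqr).
  by have := path_catE p q; rewrite epq /=; case: eqP.
- apply: (inj_omap val_inj); rewrite path_catE (path_cat_tgt epq).
  by have := path_catE q r; rewrite eqr /=; case: eqP.
Qed.

(* KQ: the vector space on the set of paths, with the product of two paths
   that do not compose being 0 *)
Definition path_algebra_car := {malg K[qpath]}.
HB.instance Definition _ := GRing.Lmodule.on path_algebra_car.
Local Notation KQ := path_algebra_car.

Definition path_mul (p q : qpath) : KQ :=
  if path_cat p q is Some r then << r >> else 0.

Definition pathalg_mul (f g : KQ) : KQ :=
  \sum_(p <- msupp f) \sum_(q <- msupp g) (f@_p * g@_q) *: path_mul p q.

Definition pathalg_one : KQ := \sum_(v : V) << trivial_path v >>.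

Fact pathalg_mulw (d1 d2 : {fset qpath}) (f g : KQ) :
  (msupp f `<=` d1)%fset -> (msupp g `<=` d2)%fset -> pathalg_mul f g =
  \sum_(p <- d1) \sum_(q <- d2) (f@_p * g@_q) *: path_mul p q.
Proof.
move=> le1 le2; rewrite /pathalg_mul (big_fset_incl _ le1) /=.
  apply: eq_bigr => p _; apply: big_fset_incl => // q _ /mcoeff_outdom ->.
  by rewrite mulr0 scale0r.
move=> p _ /mcoeff_outdom fp; rewrite big1 // => q _.
by rewrite fp mul0r scale0r.
Qed.

Fact pathalg_mulDl : left_distributive pathalg_mul +%R.
Proof.
move=> f g h; pose d := (msupp f `|` msupp g)%fset.
rewrite (@pathalg_mulw d (msupp h) (f + g)) ?msuppD_le //.
rewrite (@pathalg_mulw d (msupp h) f) ?fsubsetUl //.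
rewrite (@pathalg_mulw d (msupp h) g) ?fsubsetUr //.
rewrite -big_split; apply: eq_bigr => p _; rewrite -big_split.
by apply: eq_bigr => q _; rewrite mcoeffD mulrDl scalerDl.
Qed.

Fact pathalg_mulDr : right_distributive pathalg_mul +%R.
Proof.
move=> h f g; pose d := (msupp f `|` msupp g)%fset.
rewrite (@pathalg_mulw (msupp h) d h (f + g)) ?msuppD_le //.
rewrite (@pathalg_mulw (msupp h) d h f) ?fsubsetUl //.
rewrite (@pathalg_mulw (msupp h) d h g) ?fsubsetUr //.
rewrite -big_split; apply: eq_bigr => p _; rewrite -big_split.
by apply: eq_bigr => q _; rewrite mcoeffD mulrDr scalerDl.
Qed.

Fact pathalg_mul0l : left_zero 0 pathalg_mul.
Proof. by move=> f; rewrite /pathalg_mul msupp0 big_seq_fset0. Qed.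

Fact pathalg_mul0r : right_zero 0 pathalg_mul.
Proof.
by move=> f; rewrite /pathalg_mul big1 // => p _; rewrite msupp0 big_seq_fset0.
Qed.

Fact pathalg_mulUU (c d : K) p q :
  pathalg_mul << c *g p >> << d *g q >> = (c * d) *: path_mul p q.
Proof.
rewrite (@pathalg_mulw [fset p]%fset [fset q]%fset) ?msuppU_le //.
by rewrite !big_seq_fset1 !mcoeffUU.
Qed.

Fact pathalgE (f : KQ) : f = \sum_(p <- msupp f) << f@_p *g p >>.
Proof. exact: monalgE. Qed.

Fact pathalg_suml I (r : seq I) (F : I -> KQ) g :
  pathalg_mul (\sum_(i <- r) F i) g = \sum_(i <- r) pathalg_mul (F i) g.
Proof.
exact: (big_morph (pathalg_mul^~ g) (fun x y => pathalg_mulDl x y g)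
  (pathalg_mul0l g)).
Qed.

Fact pathalg_sumr I (r : seq I) (F : I -> KQ) g :
  pathalg_mul g (\sum_(i <- r) F i) = \sum_(i <- r) pathalg_mul g (F i).
Proof.
exact: (big_morph (pathalg_mul g) (pathalg_mulDr g) (pathalg_mul0r g)).
Qed.

Fact scale_pathU (c d : K) (p : qpath) :
  c *: (<< d *g p >> : KQ) = << c * d *g p >>.
Proof.
by apply/malgP => q; rewrite mcoeffZ !mcoeffU -mulrnAr.
Qed.

Fact pathalg_mulZl (c : K) (f g : KQ) :
  pathalg_mul (c *: f) g = c *: pathalg_mul f g.
Proof.
rewrite (@pathalg_mulw (msupp f) (msupp g) (c *: f) g) ?msuppZ_le //.
rewrite scaler_sumr; apply: eq_bigr => p _; rewrite scaler_sumr.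
by apply: eq_bigr => q _; rewrite mcoeffZ scalerA mulrA.
Qed.

Fact pathalg_mulZr (c : K) (f g : KQ) :
  pathalg_mul f (c *: g) = c *: pathalg_mul f g.
Proof.
rewrite (@pathalg_mulw (msupp f) (msupp g) f (c *: g)) ?msuppZ_le //.
rewrite scaler_sumr; apply: eq_bigr => p _; rewrite scaler_sumr.
by apply: eq_bigr => q _; rewrite mcoeffZ scalerA mulrCA.
Qed.

Fact pathalg_mulA : associative pathalg_mul.
Proof.
move=> f g h; rewrite (pathalgE f) (pathalgE g) (pathalgE h).
rewrite [LHS]pathalg_suml [X in _ = pathalg_mul X _]pathalg_suml.
rewrite [RHS]pathalg_suml; apply: eq_bigr => p _.
rewrite [X in pathalg_mul _ X = _]pathalg_suml [LHS]pathalg_sumr.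
rewrite [X in _ = pathalg_mul X _]pathalg_sumr [RHS]pathalg_suml.
apply: eq_bigr => q _.
rewrite [X in pathalg_mul _ X = _]pathalg_sumr [LHS]pathalg_sumr.
rewrite [RHS]pathalg_sumr.
apply: eq_bigr => r _; rewrite !pathalg_mulUU pathalg_mulZl pathalg_mulZr.
have U (c : K) (x : qpath) : << c *g x >> = c *: (<< x >> : KQ).
  by rewrite scale_pathU mulr1.
rewrite (U f@_p) (U h@_r) pathalg_mulZl pathalg_mulZr !scalerA.
rewrite [g@_q * _ * _]mulrC mulrA; congr (_ *: _).
have := path_catA p q r; rewrite /path_mul.
case: (path_cat q r) => [s|] /=; case: (path_cat p q) => [t|] /=;
  rewrite ?pathalg_mul0l ?pathalg_mul0r // ?pathalg_mulUU /path_mul.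
- by move=> ->; rewrite !mulr1 !scale1r.
- by move=> ->; rewrite scaler0.
- by move=> <-; rewrite scaler0.
Qed.

Fact pathalg_mul1l : left_id pathalg_one pathalg_mul.
Proof.
move=> f; rewrite {1}(pathalgE f) pathalg_sumr [RHS]pathalgE.
apply: eq_bigr => p _; rewrite /pathalg_one pathalg_suml.
rewrite (bigD1 (path_src p)) //= big1 => [|v ne].
  by rewrite addr0 pathalg_mulUU /path_mul path_cat_trivl eqxx scale_pathU
    mulr1 mul1r.
by rewrite pathalg_mulUU /path_mul path_cat_trivl (negPf ne) scaler0.
Qed.

Fact pathalg_mul1r : right_id pathalg_one pathalg_mul.
Proof.
move=> f; rewrite {1}(pathalgE f) pathalg_suml [RHS]pathalgE.
apply: eq_bigr => p _; rewrite /pathalg_one pathalg_sumr.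
rewrite (bigD1 (path_tgt p)) //= big1 => [|v ne].
  by rewrite addr0 pathalg_mulUU /path_mul path_cat_trivr eqxx scale_pathU
    !mulr1.
by rewrite pathalg_mulUU /path_mul path_cat_trivr eq_sym (negPf ne) scaler0.
Qed.

HB.instance Definition _ := GRing.Zmodule_isPzRing.Build KQ pathalg_mulA
  pathalg_mul1l pathalg_mul1r pathalg_mulDl pathalg_mulDr.

Definition pathalg_scalar (c : K) : KQ := c *: pathalg_one.

Fact pathalg_scalarM (c : K) (f : KQ) : pathalg_scalar c * f = c *: f.
Proof.
by rewrite -[LHS]/(pathalg_mul (c *: pathalg_one) f) pathalg_mulZl
  pathalg_mul1l.
Qed.

Fact pathalg_scalar_zmod : zmod_morphism pathalg_scalar.
Proof. by move=> c d; rewrite /pathalg_scalar scalerBl. Qed.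

Fact pathalg_scalar_monoid : monoid_morphism pathalg_scalar.
Proof.
split=> [|c d]; first by rewrite /pathalg_scalar scale1r.
by rewrite pathalg_scalarM /pathalg_scalar scalerA.
Qed.

HB.instance Definition _ :=
  GRing.isZmodMorphism.Build K KQ pathalg_scalar pathalg_scalar_zmod.
HB.instance Definition _ :=
  GRing.isMonoidMorphism.Build K KQ pathalg_scalar pathalg_scalar_monoid.

Fact pathalg_central (c : K) (f : KQ) :
  pathalg_scalar c * f = f * pathalg_scalar c.
Proof.
rewrite pathalg_scalarM -[RHS]/(pathalg_mul f (c *: pathalg_one)).
by rewrite pathalg_mulZr pathalg_mul1r.
Qed.

Definition path_algebra : algebra K := Algebra pathalg_central.

Definition path_elt (p : qpath) : path_algebra := (<< p >> : KQ).

End PathAlgebra.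

Arguments path_algebra K {V} Q.

Section ModuleNotions.
Variable A : pzRingType.
Implicit Types X Y M N P : lmodType A.

Definition surjective (T U : Type) (f : T -> U) := forall u, exists t, f t = u.

Definition mod_iso X Y := exists f : {linear X -> Y}, bijective f.

Definition zero_mod X := forall x : X, x = 0.

Definition finitely_generated X := exists m (g : 'I_m -> X),
  forall x, exists a : 'I_m -> A, x = \sum_k a k *: g k.

Definition direct_summand Y X :=
  exists (f : {linear Y -> X}) (g : {linear X -> Y}), cancel f g.

Definition indecomposable X := ~ zero_mod X /\
  forall Y Z : lmodType A, mod_iso X (Y * Z)%type -> zero_mod Y \/ zero_mod Z.

(* X is the direct sum of the M k, as a biproduct *)
Definition direct_sum X m (M : 'I_m -> lmodType A) :=
  exists (f : forall k, {linear M k -> X}) (g : forall k, {linear X -> M k}),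
    [/\ forall k, cancel (f k) (g k),
        forall k l, k != l -> forall y, g l (f k y) = 0
      & forall x, x = \sum_k f k (g k x)].

Definition basic X := exists m (M : 'I_m -> lmodType A),
  [/\ forall k, indecomposable (M k),
      forall k l, k != l -> ~ mod_iso (M k) (M l)
    & direct_sum X M].

(* |X| = m *)
Definition num_ind_summands X (m : nat) := exists M : 'I_m -> lmodType A,
  [/\ forall k, indecomposable (M k) /\ direct_summand (M k) X,
      forall k l, k != l -> ~ mod_iso (M k) (M l)
    & forall Y, indecomposable Y -> direct_summand Y X ->
        exists k, mod_iso Y (M k)].

Definition projective P := forall M N (g : {linear M -> N}) (f : {linear P -> N}),
  surjective g -> exists h : {linear P -> M}, forall x, g (h x) = f x.

(* ker f is superfluous: im h + ker f = P implies im h = P *)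
Definition superfluous_ker P X (f : {linear P -> X}) :=
  forall N (h : {linear N -> P}),
    (forall y, exists z, f (h z) = f y) -> surjective h.

(* P1 -d1-> P0 -d0-> X -> 0 *)
Definition min_proj_presentation P1 P0 X
    (d1 : {linear P1 -> P0}) (d0 : {linear P0 -> X}) :=
  [/\ projective P1 /\ projective P0,
      surjective d0 /\ superfluous_ker d0,
      forall y, d0 y = 0 <-> exists x, d1 x = y
    & superfluous_ker d1].

End ModuleNotions.

Section TauTilting.
Variable K : fieldType.
Implicit Types A : algebra K.

(* M is the cokernel of Hom_A(d1, A) : Hom_A(P0, A) -> Hom_A(P1, A), whose
   right A-module structure is (f.a)(x) = f(x)a; c is the projection. *)
Definition is_transpose A (P1 P0 : lmodType A) (d1 : {linear P1 -> P0})
    (M : lmodType (op A)) :=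
  exists c : {linear P1 -> A^o} -> M,
  [/\ forall f g h : {linear P1 -> A^o},
        (forall x, h x = f x + g x) -> c h = c f + c g,
      forall (a : A) (f g : {linear P1 -> A^o}),
        (forall x, g x = f x * a) -> c g = (a : op A) *: c f,
      surjective c
    & forall f, c f = 0 <->
        exists h : {linear P0 -> A^o}, forall x, f x = h (d1 x)].

Definition K_linear_form A (M : lmodType A) (phi : M -> K) :=
  (forall x y, phi (x + y) = phi x + phi y) /\
  (forall (c : K) x, phi (@alg_scalar K A c *: x) = c * phi x).

(* T is Hom_K(M, K), with left A-module structure (a.phi)(m) = phi(m.a) *)
Definition is_dual A (M : lmodType (op A)) (T : lmodType A) :=
  exists ev : T -> M -> K,
  [/\ forall t, K_linear_form (ev t),
      forall t u m, ev (t + u) m = ev t m + ev u m,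
      forall (a : A) t m, ev (a *: t) m = ev t ((a : op A) *: m),
      forall t u, ev t =1 ev u -> t = u
    & forall phi, K_linear_form phi -> exists t, ev t =1 phi].

(* T is tau X, that is D Tr X *)
Definition is_AR_translate A (X T : lmodType A) :=
  exists (P1 P0 : lmodType A) (d1 : {linear P1 -> P0}) (d0 : {linear P0 -> X})
    (M : lmodType (op A)),
  [/\ min_proj_presentation d1 d0, is_transpose d1 M & is_dual M T].

Definition tau_rigid A (X : lmodType A) := finitely_generated X /\
  exists T : lmodType A, is_AR_translate X T /\
    forall (f : {linear X -> T}) x, f x = 0.

Definition tau_tilting A (X : lmodType A) := tau_rigid X /\
  exists m, num_ind_summands X m /\ num_ind_summands (A^o : lmodType A) m.

(* An A/AeA-module is viewed as an A-module through A -> A/AeA. *)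
Definition support_tau_tilting A (X : lmodType A) :=
  exists e : A, e * e = e /\
  exists (N : lmodType (quotient_algebra (principal_ideal e))) (f : X -> N),
  [/\ @tau_tilting (quotient_algebra (principal_ideal e)) N,
      bijective f,
      forall x y, f (x + y) = f x + f y
    & forall a x, f (a *: x) = quotient_map (principal_ideal e) a *: f x].

Definition support_tau_tilting_ideal A (I : ideal A) :=
  @support_tau_tilting A (ideal_module I) /\
  @support_tau_tilting (op A) (ideal_module (op_ideal I)).

Definition basic_ideal A (I : ideal A) :=
  basic (ideal_module I) /\ basic (ideal_module (op_ideal I)).

End TauTilting.

Section Preprojective.
Variables (K : fieldType) (V : finType) (Q : quiver V).

(* [inl a] is the arrow a and [inr a] is a^* *)
Definition double_quiver : quiver V := @Quiver V (arrow Q + arrow Q)%type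
  (fun b => match b with inl a => src a | inr a => tgt a end)
  (fun b => match b with inl a => tgt a | inr a => src a end).

Definition double_arrow (b : arrow double_quiver) :
    path_algebra K double_quiver :=
  path_elt K (arrow_path b).

Definition preproj_relation : path_algebra K double_quiver :=
  \sum_(a : arrow Q)
    (double_arrow (inl a) * double_arrow (inr a)
     - double_arrow (inr a) * double_arrow (inl a)).

Definition preprojective_algebra : algebra K :=
  quotient_algebra (principal_ideal preproj_relation).

Definition vertex_idempotent (i : V) : preprojective_algebra :=
  quotient_map (principal_ideal preproj_relation)
    (path_elt K (@trivial_path V double_quiver i)).

Definition vertex_ideal (i : V) : ideal preprojective_algebra :=
  principal_ideal (1 - vertex_idempotent i).

End Preprojective.

Section Dynkin.
Local Open Scope nat_scope.

Inductive dynkin_type := DynkinA | DynkinD | DynkinE.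

Definition dynkin_size (t : dynkin_type) (n : nat) : bool :=
  match t with
  | DynkinA => 1 <= n
  | DynkinD => 4 <= n
  | DynkinE => 6 <= n <= 8
  end.

(* Vertices 0, ..., n - 1.  In types D and E the chain is 0 - ... - (n - 2)
   and n - 1 is attached to n - 3, respectively to 2. *)
Definition dynkin_edge (t : dynkin_type) (n i j : nat) : bool :=
  match t with
  | DynkinA => j == i.+1
  | DynkinD => (j == i.+1) && (j < n.-1) || (i == n - 3) && (j == n.-1)
  | DynkinE => (j == i.+1) && (j < n.-1) || (i == 2) && (j == n.-1)
  end.

Definition dynkin_adj t n i j : bool :=
  dynkin_edge t n i j || dynkin_edge t n j i.

(* The number of edges i - j of the underlying graph, or of loops when i = j *)
Definition num_edges n (Q : quiver 'I_n) (i j : 'I_n) : nat :=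
  #|[set a : arrow Q | ((src a == i) && (tgt a == j))
                    || ((src a == j) && (tgt a == i))]|.

Definition dynkin_quiver n (Q : quiver 'I_n) :=
  exists (t : dynkin_type) (s : 'I_n -> 'I_n),
  [/\ dynkin_size t n, bijective s
    & forall i j, num_edges Q i j = dynkin_adj t n (s i) (s j)].

End Dynkin.

(* Main.v *)
From HB Require Import structures.
Require Import Defs.
From mathcomp Require Import all_boot all_algebra zify.
From mathcomp Require Import finmap monalg boolp.

(** Write [e_j] for the vertex idempotents of the preprojective algebra [A] and
    [I = A (1 - e_i) A].  The double quiver has no loop, so [I] is the kernel of
    the augmentation [A -> K] at the vertex [i], and [I] is the direct sum of
    the left modules [I e_j], where [I e_j = A e_j] for [j != i] and [I e_i] is
    spanned by the nontrivial paths ending at [i].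

    Two properties of [A] are used.  The ideal spanned by the nontrivial paths
    is nilpotent.  And at the vertex [i], with [b] ranging over the arrows [j_b
    -> i], the complex [A e_i -> sum_b A e_(j_b) -> A e_i] given by the reversed
    arrows (with signs) and by the arrows is exact in the middle, the image of
    its second map is [I e_i], and the mirror image of this holds for right
    modules.  The record [preproj_vertex] states the second property in a left-
    right symmetric way, so whatever follows from it for left modules also holds
    for right modules, over the opposite algebra.

    Exactness for right modules says that every homomorphism [I -> A] is the
    right multiplication by an element of [A] ([vertex_ideal_hom]).  Hence the
    endomorphisms of [I] come from [A], an endomorphism of [I e_j] is a scalar
    plus a nilpotent map, and a composite [I e_j -> I e_k -> I e_j] with [j !=
    k] is nilpotent.  So the [I e_j] are indecomposable and pairwise non
    isomorphic, and [I] is basic with [n] summands as soon as [I e_i] is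
    nonzero, that is, for [n > 1].  Exactness for left modules provides the
    minimal projective presentation [A e_i -> P -> I]; its transpose is the
    simple right module at [i] ([transpose_simple]), so that [tau I] is the
    simple left module at [i], to which the ideal [I], generated by [1 - e_i],
    has no nonzero homomorphism.  Therefore [I] is tau-tilting over [A] if [n >
    1], whereas [I = 0] is support tau-tilting with [e = 1] if [n = 1].

    Exactness is checked in the path algebra.  The Fox derivative [fox b]
    removes a final arrow [b] from a path.  It maps the ideal of relations into
    the left ideal generated by the reversed arrow, up to relations
    ([fox_ideal]), with a coefficient that depends on the end of [b] only; this
    is exactness for left modules.  Reversing paths is an anti-automorphism and
    yields the other side.

    For nilpotency the diagram is regarded as a star with three arms, the first
    of them of length one.  The loops [x], [y], [z] that go one step into an arm
    and back satisfy [x + y + z = 0], and each is nilpotent of order at most the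
    length of its arm plus one.  A walk that starts at the centre equals a word
    in these loops times a direct path, and a walk that avoids the centre for
    long is zero ([star_walks_vanish]).  It remains to bound the nonzero words
    in the loops.  This is immediate in types A and D; in type E one has [x ^ 2
    = y ^ 3 = (x + y) ^ 5 = 0], and a Groebner basis of these relations with
    leading coefficients one shows that all words of length 15 vanish
    ([words_vanish235]), in every characteristic. *)

Set Implicit Arguments.
Unset Strict Implicit.
Unset Printing Implicit Defensive.

Import GRing.Theory.
Local Open Scope ring_scope.

(** * Kernels and retracts of modules *)

Definition lin_of (A : pzRingType) (X Y : lmodType A) (h : X -> Y)
    (hl : linear h) : {linear X -> Y} :=
  HB.pack h (GRing.isLinear.Build A X Y *:%R h hl).

Section Kernel.
Variables (A : pzRingType) (X Y : lmodType A) (f : {linear X -> Y}).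

Definition kernel := {x : X | f x == 0}.
HB.instance Definition _ := SubChoice.on kernel.

Fact kernel_closed : subsemimod_closed (fun x : X => f x == 0).
Proof.
split; last by move=> a x /eqP fx; apply/eqP; rewrite linearZ /= fx scaler0.
split=> [|x y]; first by apply/eqP; rewrite linear0.
by move=> /eqP fx /eqP fy; apply/eqP; rewrite linearD fx fy addr0.
Qed.

HB.instance Definition _ := GRing.SubChoice_isSubLmodule.Build A X
  (fun x => f x == 0) kernel kernel_closed.

Definition kernel_incl : {linear kernel -> X} := (val : kernel -> X).

Lemma kernelP (u : kernel) : f (val u) = 0.
Proof. exact/eqP/(valP u). Qed.

Section Lift.
Variables (Z : lmodType A) (g : {linear Z -> X}) (gK : forall z, f (g z) == 0).

Fact kernel_lift_linear : linear (fun z => exist _ (g z) (gK z) : kernel).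
Proof. by move=> a x y; apply: val_inj; rewrite /= linearP. Qed.

Definition kernel_lift : {linear Z -> kernel} := lin_of kernel_lift_linear.
End Lift.
End Kernel.

Section Retracts.
Variable A : pzRingType.
Implicit Types X Y Z M : lmodType A.

(** An indecomposable module has no proper nonzero retract: it splits as the
    image of the retraction and its kernel. *)
Lemma indecomposable_retract M Y (f : {linear M -> Y}) (g : {linear Y -> M}) :
  cancel f g -> indecomposable Y -> ~ zero_mod M -> mod_iso Y M.
Proof.
move=> fK [_ indY] nzM.
have cL : linear (fun y => y - f (g y)).
  by move=> a x y; rewrite !linearP /= scalerDr addrACA.
have cK y : g (lin_of cL y) == 0 by rewrite /= linearB /= fK subrr.
pose c := kernel_lift cK.
have pL : linear (fun y => (g y, c y)).
  by move=> a x y; rewrite !linearP.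
have iso : mod_iso Y (M * kernel g)%type.
  exists (lin_of pL); exists (fun u => f u.1 + val u.2) => [y|[m z]] /=.
    by rewrite addrC subrK.
  have gE : g (f m + val z) = m by rewrite linearD fK kernelP addr0.
  congr (_, _); first exact: gE.
  by apply: val_inj; rewrite /= gE addrC addKr.
case: (indY _ _ iso) => // ker0; exists g; exists f => // y.
by have := congr1 val (ker0 (c y)); move/eqP; rewrite /= subr_eq0 => /eqP.
Qed.

End Retracts.

(** * Algebras with nilpotent radical *)

(** A basic algebra over [K] with [n] simple modules, all one-dimensional: [aug
    j] is the action on the [j]-th of them.  The common kernel of the
    augmentations is the radical, and [aug_nilp] says that it is nilpotent. *)
Record elementary (K : fieldType) (A : algebra K) (n : nat) := Elementary {
  idem : 'I_n -> A;
  aug : 'I_n -> {rmorphism A -> K};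
  idemM : forall j k, idem j * idem k = if j == k then idem j else 0;
  idem_sum : \sum_j idem j = 1;
  aug_scalar : forall j c, aug j (@alg_scalar K A c) = c;
  aug_idem : forall j k, aug j (idem k) = (j == k)%:R;
  aug_nilp : exists N, forall vs : seq A,
    size vs = N -> (forall x, x \in vs -> forall j, aug j x = 0) ->
    \prod_(x <- vs) x = 0
}.

Section Corner.
Variables (K : fieldType) (A : algebra K) (n : nat) (E : elementary A n).
Local Notation e := (idem E).
Local Notation chi := (aug E).
Local Notation sc := (@alg_scalar K A).

Definition rad (x : A) := forall j, chi j x = 0.

Lemma idemK j : e j * e j = e j.
Proof. by rewrite idemM eqxx. Qed.

Lemma idem_ortho j k : j != k -> e j * e k = 0.
Proof. by rewrite idemM => /negPf->. Qed.

Lemma idem_neq0 j : e j <> 0.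
Proof.
move=> e0; have := aug_idem E j j; rewrite e0 rmorph0 eqxx => /esym/eqP.
by rewrite oner_eq0.
Qed.

Lemma aug_off j k x : x * e k = x -> j != k -> chi j x = 0.
Proof. by move=> <- jk; rewrite rmorphM aug_idem (negPf jk) mulr0. Qed.

Lemma aug_offl j k x : e k * x = x -> j != k -> chi j x = 0.
Proof. by move=> <- jk; rewrite rmorphM aug_idem (negPf jk) mul0r. Qed.

Lemma rad_exp x : rad x -> exists N, x ^+ N.+1 = 0.
Proof.
move=> rx; have [N nil] := aug_nilp E; exists N.
have := nil (nseq N x) (size_nseq _ _); rewrite big_nseq -Monoid.iteropE => H.
by rewrite exprS [_ ^+ N]H ?mulr0 // => y /nseqP[-> _].
Qed.

(** A corner [e k * A * e k] is local: up to a scalar, [x] is [e k] minus a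
    radical element, and the geometric series inverts it. *)
Lemma corner_unit k x : e k * x = x -> x * e k = x -> chi k x != 0 ->
  exists w, x * w = e k /\ w * x = e k.
Proof.
move=> ex xe nz; pose c := sc (chi k x); pose c' := sc (chi k x)^-1.
have cc : c * c' = 1 by rewrite -rmorphM divff // rmorph1.
have c'c : c' * c = 1 by rewrite -rmorphM mulVf // rmorph1.
have cC := @alg_central K A (chi k x);
  have c'C := @alg_central K A (chi k x)^-1.
(* Now [x = c * (1 - u) * e k] with [u] in the radical. *)
pose u := e k - c' * x.
have ru : rad u.
  move=> j; rewrite rmorphB rmorphM aug_scalar aug_idem.
  case: eqP => [->|/eqP jk]; first by rewrite mulVf // subrr.
  by rewrite (aug_off xe jk) mulr0 subr0.
have eu : e k * u = u by rewrite mulrBr idemK mulrA -c'C -mulrA ex.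
have ue : u * e k = u by rewrite mulrBl idemK -mulrA xe.
have [N uN] := rad_exp ru; pose S := \sum_(i < N.+1) u ^+ i.
have uS : (1 - u) * S = 1.
  by have := subrX1 u N.+1; rewrite uN sub0r -[X in _ = X * _]opprB mulNr =>
    /oppr_inj.
have Su : S * (1 - u) = 1.
  have cS : GRing.comm u S.
    by apply: commr_sum => i _; apply: commrX.
  by rewrite mulrBr mulr1 -cS -[X in X - _]mul1r -mulrBl.
have cSe : S * e k = e k * S.
  rewrite mulr_suml mulr_sumr; apply: eq_bigr => i _.
  have: GRing.comm (e k) u by rewrite /GRing.comm eu ue.
  by move/(@commrX _ _ _ i).
have xE : x = c * (1 - u) * e k.
  by rewrite -mulrA mulrBl mul1r ue opprB addrC subrK mulrA cc mul1r.
have c'CA a y : a * (c' * y) = c' * (a * y) by rewrite mulrA -c'C -mulrA.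
have cCA a y : a * (c * y) = c * (a * y) by rewrite mulrA -cC -mulrA.
exists (c' * (S * e k)); split; rewrite xE -!mulrA.
  rewrite !c'CA (mulrA c') c'c mul1r [e k * _]mulrA -cSe -mulrA idemK.
  by rewrite mulrA uS mul1r.
rewrite !cCA (mulrA c) cc mul1r [e k * _]mulrA.
have cue : e k * (1 - u) =
  (1 - u) * e k by rewrite mulrBr mulrBl mulr1 mul1r eu ue.
by rewrite cue -mulrA idemK mulrA Su mul1r.
Qed.
End Corner.

(** * Modules whose endomorphisms come from the algebra *)

(** In this section every endomorphism of [X] is given by an element of [A], and
    [r] reverses products, as right multiplications do. *)
Section Summands.
Variables (K : fieldType) (A : algebra K) (n : nat) (E : elementary A n).
Variables (X : lmodType A) (r : A -> {linear X -> X}).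
Hypothesis rD : forall a b x, r (a + b) x = r a x + r b x.
Hypothesis rM : forall a b x, r (a * b) x = r b (r a x).
Hypothesis r1 : forall x, r 1 x = x.
Hypothesis r_full : forall f : {linear X -> X}, exists a, forall x, f x = r a x.
Hypothesis r_idem_neq0 : forall k, exists x, r (idem E k) x <> 0.
Local Notation e := (idem E).
Local Notation chi := (aug E).

Lemma r0 x : r 0 x = 0.
Proof. by apply: (addrI (r 0 x)); rewrite -rD !addr0. Qed.

Lemma r_sum (I : Type) (s : seq I) (F : I -> A) x :
  r (\sum_(i <- s) F i) x = \sum_(i <- s) r (F i) x.
Proof. exact: (big_morph (fun a => r a x) (fun a b => rD a b x) (r0 x)). Qed.

Definition fix_map k : {linear X -> X} := r (e k) \- idfun.

Definition summand k : lmodType A := kernel (fix_map k).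

Lemma summand_fix k (u : summand k) : r (e k) (val u) = val u.
Proof. by have /eqP := kernelP u; rewrite subr_eq0 => /eqP. Qed.

Fact proj_subproof k x : fix_map k (r (e k) x) == 0.
Proof. by rewrite /= -rM idemK subrr. Qed.

Definition summand_proj k : {linear X -> summand k} :=
  kernel_lift (proj_subproof k).

Definition summand_incl k : {linear summand k -> X} := kernel_incl (fix_map k).

Lemma summand_inclK k : cancel (summand_incl k) (summand_proj k).
Proof. by move=> u; apply: val_inj; apply: summand_fix. Qed.

Lemma summand_neq0 k : ~ zero_mod (summand k).
Proof.
move=> z0; have [x nx] := r_idem_neq0 k; apply: nx.
exact: (congr1 val (z0 (summand_proj k x))).
Qed.

Lemma summand_hom k l (f : {linear summand k -> summand l}) :
  exists a, [/\ e k * a = a, a * e l = a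
    & forall u, val (f u) = r a (val u)].
Proof.
pose g : {linear X -> X} := summand_incl l \o f \o summand_proj k.
have [a fa] := r_full g; exists (e k * a * e l); split.
- by rewrite !mulrA idemK.
- by rewrite -!mulrA idemK.
- move=> u; rewrite !rM summand_fix -fa /= -[in LHS](summand_fix (f u)).
  congr (r _ (val (f _))); apply: esym; exact: summand_inclK.
Qed.

Lemma r_exp a m x : r (a ^+ m) x = iter m (r a) x.
Proof.
by elim: m x => [|m IH] x; rewrite ?expr0 ?r1 // exprSr rM IH.
Qed.

(** An idempotent endomorphism of [summand k] is a scalar plus a nilpotent map,
    so it is zero or bijective. *)
Lemma summand_indecomposable k : indecomposable (summand k).
Proof.
split=> [|Y Z [f [g fK gK]]]; first exact: summand_neq0.
pose gl := lin_of (can2_linear fK gK).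
have pL : linear (fun u : Y * Z => (u.1, 0 : Z)).
  move=> a u v; rewrite [LHS]/=; congr (_, _).
  by rewrite /= scaler0 addr0.
pose p : {linear summand k -> summand k} := gl \o lin_of pL \o f.
have pE u : p u = g ((f u).1, 0) by [].
have pp u : p (p u) = p u by rewrite !pE gK.
have [a [ea ae pa]] := summand_hom p.
case: (eqVneq (chi k a) 0) => [a0|nz].
  left=> y.
  have ra : rad E a.
    by move=> j; case: (eqVneq j k) => [->//|jk]; apply: (aug_off ae).
  have [N aN] := rad_exp ra.
  have itp m u : val (iter m p u) = r (a ^+ m) (val u).
    by elim: m u => [|m IH] u; rewrite ?expr0 ?r1 // exprSr rM -IH /= pa.
  have fixp m u : iter m.+1 p u = p u by elim: m => [//|m IH];
    rewrite iterS IH pp.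
  have p0 u : p u = 0.
    by apply: val_inj; rewrite -(fixp N) itp aN r0.
  by have := congr1 f (p0 (g (y, 0))); rewrite pE !gK linear0 => -[].
have [b [ab ba]] := corner_unit ea ae nz.
have pI u : p u = 0 -> u = 0.
  move=> pu0; apply: val_inj.
  by rewrite -(summand_fix u) -ab rM -pa pu0 /= linear0.
right=> z; have := pI (g (0, z)); rewrite pE gK /=.
have g0 : g (0, 0) = 0 by exact: (linear0 gl).
by move/(_ g0)/(congr1 f); rewrite gK linear0 => -[].
Qed.

(** A composite of maps between two different summands comes from the radical,
    so it is nilpotent and cannot be the identity. *)
Lemma summand_niso k l : k != l -> ~ mod_iso (summand k) (summand l).
Proof.
move=> kl [f [g fK gK]]; pose gl := lin_of (can2_linear fK gK).
have [a [ea ae fa]] := summand_hom f; have [b [eb be gb]] := summand_hom gl.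
have rab : rad E (a * b).
  move=> j; rewrite rmorphM; case: (eqVneq j k) => [->|jk].
    by rewrite (aug_off ae kl) mul0r.
  by rewrite (aug_offl ea jk) mul0r.
have [N abN] := rad_exp rab.
apply: (@summand_neq0 k) => u; apply: val_inj.
have abu : r (a * b) (val u) = val u by rewrite rM -fa -gb /= fK.
have: r ((a * b) ^+ N.+1) (val u) = val u.
  by rewrite r_exp; elim: N.+1 => //= m ->.
by rewrite abN r0.
Qed.

Lemma summand_sum x : x = \sum_k summand_incl k (summand_proj k x).
Proof. by rewrite -{1}(r1 x) -(idem_sum E) r_sum. Qed.

Lemma summands_direct : direct_sum X summand.
Proof.
exists summand_incl, summand_proj; split.
- exact: summand_inclK.
- move=> k l kl u; apply: val_inj; rewrite /= -(summand_fix u) -rM.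
  by rewrite idem_ortho // r0.
- exact: summand_sum.
Qed.

Lemma full_basic : basic X.
Proof.
exists n, summand; split; [exact: summand_indecomposable|exact: summand_niso|].
exact: summands_direct.
Qed.

(** Krull-Schmidt: the idempotent of [X] cut out by a nonzero summand [Y] is
    given by some [a], which is not nilpotent, so it is nonzero modulo the
    radical, hence a unit in one of the corners [e k * A * e k]; then
    [summand k] is a retract of [Y]. *)
Lemma full_summand Y : indecomposable Y -> direct_summand Y X ->
  exists k, mod_iso Y (summand k).
Proof.
move=> indY [f [g fK]]; pose p : {linear X -> X} := f \o g.
have [a pa] := r_full p.
have [ra|nra] := pselect (rad E a).
  have [N aN] := rad_exp ra; case: indY => nzY _; case: nzY => y.
  have pf m : iter m p (f y) = f y by elim: m => //= m ->; rewrite fK.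
  have ia m x : iter m p x = iter m (r a) x by elim: m => //= m ->; rewrite -pa.
  by apply: (can_inj fK); rewrite linear0 -(pf N.+1) ia -r_exp aN r0.
have [k nz] : exists k, chi k a != 0.
  apply: contrapT => H; apply: nra => j; apply/eqP/negPn/negP => nz.
  by apply: H; exists j.
exists k; have [b [ab ba]] : exists b, (e k * a * e k) * b = e k /\
    b * (e k * a * e k) = e k.
  apply: corner_unit; rewrite ?mulrA ?idemK -?mulrA ?idemK //.
  by rewrite !rmorphM !aug_idem eqxx mulr1 mul1r.
pose f' : {linear Y -> summand k} := summand_proj k \o r b \o r (e k) \o f.
pose g' : {linear summand k -> Y} := g \o summand_incl k.
apply: (indecomposable_retract (f := g') (g := f')) => //; last first.
  exact: summand_neq0.
move=> u; apply: val_inj => /=.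
rewrite -[f (g _)]/(p _) pa -[sval u]/(val u) -(summand_fix u) -!rM !mulrA.
have -> : e k * a * e k * b * e k = e k by rewrite ab idemK.
by rewrite summand_fix.
Qed.

Lemma full_num_ind_summands : num_ind_summands X n.
Proof.
exists summand; split=> [k||].
- split; first exact: summand_indecomposable.
  by exists (summand_incl k), (summand_proj k); apply: summand_inclK.
- exact: summand_niso.
- exact: full_summand.
Qed.

End Summands.

(** * The ideal at a vertex *)

(** The part of the structure of a preprojective algebra that concerns one
    vertex [i]: [nbr] indexes the arrows [inn b : nbrv b -> i], and [out b] is
    the reversed arrow with a sign.  The maps [A e_i -> sum_b A e_(nbrv b) -> A
    e_i] given by the [out b] and the [inn b] form a complex by [out_inn];
    [inn_exact] is its exactness in the middle, and [inn_gen] says that its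
    image on the right is the radical part of [A e_i].  [out_exact] and
    [out_gen] say the same for right modules, so that exchanging [inn] and [out]
    gives this structure on the opposite algebra. *)
Record preproj_vertex (K : fieldType) (A : algebra K) (n : nat)
    (E : elementary A n) (i : 'I_n) := PreprojVertex {
  nbr : finType;
  nbr0 : nbr;
  nbrv : nbr -> 'I_n;
  inn : nbr -> A;
  out : nbr -> A;
  nbrv_neq : forall b, nbrv b != i;
  inn_l : forall b, idem E (nbrv b) * inn b = inn b;
  inn_r : forall b, inn b * idem E i = inn b;
  out_l : forall b, idem E i * out b = out b;
  out_r : forall b, out b * idem E (nbrv b) = out b;
  out_inn : \sum_b out b * inn b = 0;
  inn_gen : forall x, x * idem E i = x -> aug E i x = 0 ->
    exists y : nbr -> A, x = \sum_b y b * inn b;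
  out_gen : forall x, idem E i * x = x -> aug E i x = 0 ->
    exists y : nbr -> A, x = \sum_b out b * y b;
  inn_exact : forall x : nbr -> A, (forall b, x b * idem E (nbrv b) = x b) ->
    \sum_b x b * inn b = 0 -> exists a, forall b, x b = a * out b;
  out_exact : forall x : nbr -> A, (forall b, idem E (nbrv b) * x b = x b) ->
    \sum_b out b * x b = 0 -> exists a, forall b, x b = inn b * a
}.

Section FullModules.
Variables (K : fieldType) (A : algebra K) (n : nat) (E : elementary A n).
Local Notation e := (idem E).

Fact regular_mulr_linear (a : A) : linear (fun x : A^o => (x * a : A^o)).
Proof. by move=> c x y; rewrite mulrDl -mulrA. Qed.

Definition regular_mulr a : {linear A^o -> A^o} :=
  lin_of (regular_mulr_linear a).

Lemma regular_num_ind_summands : num_ind_summands (A^o : lmodType A) n.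
Proof.
apply: (@full_num_ind_summands _ _ _ E _ regular_mulr) => /=.
- by move=> a b x; rewrite mulrDr.
- by move=> a b x; rewrite mulrA.
- by move=> x; rewrite mulr1.
- move=> f; exists (f 1) => x; rewrite -[x in LHS]mulr1.
  by rewrite -[x * 1]/(x *: (1 : A^o)) linearZ.
- by move=> k; exists 1; rewrite mul1r; apply: idem_neq0.
Qed.

Variable (I : ideal A).

Definition ideal_sub (x : A) (Ix : x \in I) : ideal_module I := exist _ x Ix.

Lemma ideal_subZ (a x : A) (Ix : x \in I) :
  a *: ideal_sub Ix = ideal_sub (ideal_mull a Ix).
Proof. exact: val_inj. Qed.

Fact ideal_mulr_linear (a : A) : linear (fun x : ideal_module I =>
  ideal_sub (ideal_mulr a (valP x))).
Proof. by move=> c x y; apply: val_inj; rewrite /= mulrDl -mulrA. Qed.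

Definition ideal_mulr_map a : {linear ideal_module I -> ideal_module I} :=
  lin_of (ideal_mulr_linear a).

Fact ideal_incl_linear : linear (val : ideal_module I -> A^o).
Proof. by move=> a x y; rewrite linearP. Qed.

Definition ideal_incl : {linear ideal_module I -> A^o} :=
  lin_of ideal_incl_linear.

Hypothesis I_hom : forall f : {linear ideal_module I -> A^o},
  exists a, forall x, f x = val x * a.
Hypothesis I_idem : forall k, exists2 x, x \in I & x * e k <> 0.

Lemma ideal_full :
  [/\ forall a b x, ideal_mulr_map (a + b) x =
    ideal_mulr_map a x + ideal_mulr_map b x,
      forall a b x, ideal_mulr_map (a * b) x =
        ideal_mulr_map b (ideal_mulr_map a x),
      forall x, ideal_mulr_map 1 x = x,
      forall f : {linear ideal_module I -> ideal_module I},
        exists a, forall x, f x = ideal_mulr_map a x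
    & forall k, exists x, ideal_mulr_map (e k) x <> 0].
Proof.
split.
- by move=> a b x; apply: val_inj; rewrite /= mulrDr.
- by move=> a b x; apply: val_inj; rewrite /= mulrA.
- by move=> x; apply: val_inj; rewrite /= mulr1.
- move=> f; have [a fa] := I_hom (ideal_incl \o f).
  by exists a => x; apply: val_inj; rewrite /= -fa.
- move=> k; have [x Ix nz] := I_idem k; exists (ideal_sub Ix) => /(congr1 val).
  exact: nz.
Qed.

Lemma ideal_basic : basic (ideal_module I).
Proof. by have [? ? ? ? ?] := ideal_full;
  apply: (@full_basic _ _ _ E _ ideal_mulr_map). Qed.

Lemma ideal_num_ind_summands : num_ind_summands (ideal_module I) n.
Proof.
by have [? ? ? ? ?] := ideal_full;
  apply: (@full_num_ind_summands _ _ _ E _ ideal_mulr_map).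
Qed.

End FullModules.

Section VertexIdeal.
Variables (K : fieldType) (A : algebra K) (n : nat) (E : elementary A n).
Variables (i : 'I_n) (F : preproj_vertex E i) (I : ideal A).
Hypothesis I_mem : forall x, (x \in I) = (aug E i x == 0).
Local Notation e := (idem E).

Lemma I_idem_mem j : j != i -> e j \in I.
Proof. by rewrite I_mem aug_idem eq_sym => /negPf->. Qed.

Lemma aug_inn j (b : nbr F) : aug E j (inn b) = 0.
Proof.
case: (eqVneq j i) => [->|ji]; last exact: (aug_off (inn_r b) ji).
by apply: (aug_offl (inn_l b)); rewrite eq_sym nbrv_neq.
Qed.

Lemma aug_out j (b : nbr F) : aug E j (out b) = 0.
Proof.
case: (eqVneq j i) => [->|ji]; last exact: (aug_offl (out_l b) ji).
by apply: (aug_off (out_r b)); rewrite eq_sym nbrv_neq.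
Qed.

Lemma I_inn (b : nbr F) : inn b \in I.
Proof. by rewrite I_mem aug_inn. Qed.

(** If [inn b] were zero, exactness would put the idempotent [e (nbrv b)] into
    the radical. *)
Lemma inn_neq0 (b : nbr F) : inn b <> 0.
Proof.
move=> b0; pose x c : A := if c == b then e (nbrv b) else 0.
case: (@inn_exact _ _ _ _ _ F x) => [c||a xa].
- by rewrite /x; case: eqP => [->|_]; rewrite ?idemK ?mul0r.
- rewrite big1 // => c _; rewrite /x; case: eqP => [->|_];
  last by rewrite mul0r.
  by rewrite b0 mulr0.
have := aug_idem E (nbrv b) (nbrv b); have := xa b.
by rewrite /x eqxx => ->; rewrite rmorphM aug_out mulr0 eqxx => /esym/eqP;
  rewrite oner_eq0.
Qed.

Lemma out_neq0 (b : nbr F) : out b <> 0.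
Proof.
move=> b0; pose x c : A := if c == b then e (nbrv b) else 0.
case: (@out_exact _ _ _ _ _ F x) => [c||a xa].
- by rewrite /x; case: eqP => [->|_]; rewrite ?idemK ?mulr0.
- rewrite big1 // => c _; rewrite /x; case: eqP => [->|_];
  last by rewrite mulr0.
  by rewrite b0 mul0r.
have := aug_idem E (nbrv b) (nbrv b); have := xa b.
by rewrite /x eqxx => ->; rewrite rmorphM aug_inn mul0r eqxx => /esym/eqP;
  rewrite oner_eq0.
Qed.

Lemma vertex_ideal_decomp x : x \in I -> exists z : nbr F -> A,
  x = \sum_(j | j != i) x * e j + \sum_b z b * inn b /\
  x * e i = \sum_b z b * inn b.
Proof.
rewrite I_mem => /eqP x0.
have [||z xz] := inn_gen F (x := x * e i); first by rewrite -mulrA idemK.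
  by rewrite rmorphM x0 mul0r.
exists z; split=> //.
by rewrite -xz -{1}[x]mulr1 -(idem_sum E) mulr_sumr (bigD1 i) //= addrC.
Qed.

(** The values [f (e j)], [j != i], and [f (inn b)] determine [f].  Applying [f]
    to the relation [out_inn] gives a relation between the [f (inn b)] to which
    [out_exact] applies: they are the products of the [inn b] with one element,
    which serves for all of [I e_i]. *)
Lemma vertex_ideal_hom (f : {linear ideal_module I -> A^o}) :
  exists a, forall x, f x = val x * a.
Proof.
(* [g] extends [f] by zero, to compute with elements of [A]. *)
pose g (x : A) : A := if insub x is Some u then f (u : ideal_module I) else 0.
have gE (u : ideal_module I) : g (val u) = f u by rewrite /g valK.
have gS x (Ix : x \in I) : g x = f (ideal_sub Ix) by rewrite -gE.
have gZ a x : x \in I -> g (a * x) = a * g x.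
  move=> Ix; rewrite (gS _ Ix) (gS _ (ideal_mull a Ix)) -ideal_subZ.
  by rewrite linearZ.
have gsum (T : finType) (P : pred T)
  (G : T -> A) : (forall t, P t -> G t \in I) ->
    g (\sum_(t | P t) G t) = \sum_(t | P t) g (G t).
  move=> IG.
  have IG' t : (if P t then G t else 0) \in I.
    by case: ifP => [/IG//|_]; rewrite rpred0.
  have -> : \sum_(t | P t) G t = val (\sum_(t | P t) (ideal_sub (IG' t))).
    by rewrite raddf_sum; apply: eq_bigr => t /= ->.
  rewrite gE linear_sum; apply: eq_bigr => t Pt; rewrite -gE /=.
  by rewrite Pt.
have [||b Hb] := @out_exact _ _ _ _ _ F (fun b : nbr F => g (inn b)).
- by move=> b; rewrite -gZ ?I_inn // inn_l.
- rewrite (eq_bigr _ (fun b _ => esym (gZ (out b) _ (I_inn b)))) -gsum.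
    by rewrite out_inn (gE 0) linear0.
  by move=> b _; apply/ideal_mull/I_inn.
exists (\sum_(j | j != i) g (e j) + e i * b) => x; rewrite -gE.
set y := val x; have Iy : y \in I := valP x.
have [z [yE yz]] := vertex_ideal_decomp Iy.
have gD u v : u \in I -> v \in I -> g (u + v) = g u + g v.
  move=> Iu Iv; rewrite (gS _ Iu) (gS _ Iv) -linearD -gE.
  by [].
rewrite {1}yE gD; first last.
- by rewrite rpred_sum // => c _; apply/ideal_mull/I_inn.
- by rewrite rpred_sum // => j ji; apply/ideal_mull/I_idem_mem.
rewrite !gsum => [|c _|j ji]; first last.
- exact/ideal_mull/I_idem_mem.
- exact/ideal_mull/I_inn.
rewrite mulrDr mulr_sumr mulrA yz mulr_suml; congr (_ + _).
  by apply: eq_bigr => j ji; rewrite gZ // I_idem_mem.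
by apply: eq_bigr => c _; rewrite gZ ?I_inn // Hb mulrA.
Qed.

Lemma vertex_ideal_idem k : exists2 x, x \in I & x * e k <> 0.
Proof.
case: (eqVneq k i) => [->|ki].
  exists (inn (nbr0 F)); first exact: I_inn.
  by rewrite inn_r; apply: inn_neq0.
by exists (e k); [exact: I_idem_mem|rewrite idemK; apply: idem_neq0].
Qed.

Lemma vertex_ideal_basic : basic (ideal_module I).
Proof. exact: ideal_basic vertex_ideal_hom vertex_ideal_idem. Qed.

Lemma vertex_ideal_num_ind_summands : num_ind_summands (ideal_module I) n.
Proof. exact: ideal_num_ind_summands vertex_ideal_hom vertex_ideal_idem. Qed.

End VertexIdeal.

(** * Projective covers and simple modules *)

(** [projsum d] is the direct sum of the projective modules [A * d t], realised
    as the families [x] with [x t * d t = x t].  A zero idempotent is allowed,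
    so an index type may contain more elements than there are nonzero
    summands. *)
Section ProjectiveSum.
Variables (A : pzRingType) (T : finType) (d : T -> A).
Hypothesis dK : forall t, d t * d t = d t.

Fact cut_linear : linear (fun x : {ffun T -> A^o} =>
  [ffun t => x t * d t - x t : A^o]).
Proof.
move=> a x y; apply/ffunP => t; rewrite !ffunE.
by rewrite mulrDl opprD addrACA scalerBr /= -mulrA.
Qed.

Definition projsum : lmodType A := kernel (lin_of cut_linear).

Definition coord (u : projsum) (t : T) : A := (val u : {ffun T -> A^o}) t.

Lemma coord_inj u v : coord u =1 coord v -> u = v.
Proof. by move=> uv; apply/val_inj/ffunP/uv. Qed.

Lemma projsum_cut (u : projsum) t : coord u t * d t = coord u t.
Proof.
have /ffunP/(_ t) := kernelP u; rewrite !ffunE => /eqP.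
by rewrite subr_eq0 => /eqP.
Qed.

Lemma coordP a (u v : projsum) t :
  coord (a *: u + v) t = a * coord u t + coord v t.
Proof. by rewrite /coord linearP !ffunE. Qed.

Lemma coordZ a (u : projsum) t : coord (a *: u) t = a * coord u t.
Proof. by rewrite /coord linearZ /= ffunE. Qed.

Fact projsum_subproof (x : T -> A) : (forall t, x t * d t = x t) ->
  lin_of cut_linear [ffun t => (x t : A^o)] == 0.
Proof.
by move=> xd; apply/eqP/ffunP => t; rewrite !ffunE xd subrr.
Qed.

Definition mk_projsum x (xd : forall t, x t * d t = x t) : projsum :=
  exist _ [ffun t => x t : A^o] (projsum_subproof xd).

Lemma mk_coord x (xd : forall t, x t * d t = x t) t :
  coord (mk_projsum xd) t = x t.
Proof. by rewrite /coord ffunE. Qed.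

Fact basis_subproof t s :
  (if s == t then d t else 0) * d s = if s == t then d t else 0.
Proof. by case: eqP => [->|_]; rewrite ?mul0r. Qed.

Definition projsum_basis t : projsum := mk_projsum (basis_subproof t).

Lemma projsum_expand (u : projsum) : u = \sum_t coord u t *: projsum_basis t.
Proof.
apply: val_inj; rewrite raddf_sum; apply/ffunP => t; rewrite sum_ffunE.
rewrite (bigD1 t) //= big1 => [|s st]; rewrite !ffunE ?eqxx.
  by rewrite addr0; apply/esym/projsum_cut.
by rewrite eq_sym (negPf st) scaler0.
Qed.

Lemma projsum_linE (M : lmodType A) (f : {linear projsum -> M}) u :
  f u = \sum_t coord u t *: f (projsum_basis t).
Proof.
by rewrite {1}[u]projsum_expand linear_sum; apply: eq_bigr => t _;
  rewrite linearZ.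
Qed.

Fact projsum_map_linear (M : lmodType A) (m : T -> M) :
  linear (fun u : projsum => \sum_t coord u t *: m t).
Proof.
move=> a u v; rewrite scaler_sumr -big_split; apply: eq_bigr => t _ /=.
by rewrite coordP scalerDl scalerA.
Qed.

Definition projsum_map (M : lmodType A) (m : T -> M) : {linear projsum -> M} :=
  lin_of (projsum_map_linear m).

Lemma projsum_mapE (M : lmodType A) (m : T -> M) u :
  projsum_map m u = \sum_t coord u t *: m t.
Proof. by []. Qed.

Lemma projsum_projective : projective projsum.
Proof.
move=> M N g f gS; have [m gm] := choice (fun t => gS (f (projsum_basis t))).
exists (projsum_map m) => u; rewrite [RHS]projsum_linE linear_sum.
by apply: eq_bigr => t _; rewrite linearZ /= gm.
Qed.

End ProjectiveSum.

(** Nakayama's lemma, with a nilpotent radical.  An element of the projective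
    module is, modulo the image of [h], a radical combination of the basis;
    after substituting this into itself often enough the coefficients vanish. *)
Lemma projsum_superfluous (K : fieldType) (A : algebra K) (n : nat)
    (E : elementary A n) (T : finType) (d : T -> A)
      (dK : forall t, d t * d t = d t)
    (X : lmodType A) (f : {linear projsum d -> X}) :
  (forall u, f u = 0 -> forall t, rad E (coord u t)) -> superfluous_ker f.
Proof.
move=> kerf N h hS; have [m nil] := aug_nilp E.
have step (k : nat) : forall vs : seq A, (size vs + k = m)%N ->
    (forall x, x \in vs -> rad E x) -> forall u,
    exists z, h z = (\prod_(x <- vs) x) *: u.
  elim: k => [|k IH] vs.
    rewrite addn0 => sz rv u; exists 0.
    by rewrite linear0 nil // scale0r.
  move=> sz rv u; have [z fz] := hS u.
  have ru t : rad E (coord (u - h z) t).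
    by apply: kerf; rewrite linearB /= fz subrr.
  have H t : exists w,
    h w = (\prod_(x <- rcons vs (coord (u - h z) t)) x) *: projsum_basis dK t.
    apply: IH; first by rewrite size_rcons addSnnS.
    by move=> x; rewrite mem_rcons inE => /orP[/eqP->|/rv].
  have [w hw] := choice H.
  exists ((\prod_(x <- vs) x) *: z + \sum_t w t).
  rewrite linearD linearZ linear_sum /= (eq_bigr _ (fun t _ => hw t)).
  rewrite -[X in _ = _ *: X](subrK (h z)) addrC scalerDr; congr (_ + _).
  rewrite [u - h z in RHS](projsum_expand dK) scaler_sumr;
    apply: eq_bigr => t _.
  by rewrite -cats1 big_cat big_seq1 scalerA.
move=> u; have [z hz] := step m [::] erefl (fun x => ltac:(by [])) u.
by exists z; rewrite hz big_nil scale1r.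
Qed.

Section SimpleModule.
Variables (K : fieldType) (A : pzRingType) (chi : {rmorphism A -> K}).

(** The ignored argument records in the type through which augmentation the
    algebra acts on [K]. *)
Definition simple_of (_ : {rmorphism A -> K}) := K.
Local Notation S := (simple_of chi).
HB.instance Definition _ := GRing.Zmodule.on S.

Definition simple_scale (a : A) (x : S) : S := chi a * (x : K).

Fact simple_scaleA a b x :
  simple_scale a (simple_scale b x) = simple_scale (a * b) x.
Proof. by rewrite /simple_scale rmorphM mulrA. Qed.
Fact simple_scale1 : left_id 1 simple_scale.
Proof. by move=> x; rewrite /simple_scale rmorph1 mul1r. Qed.
Fact simple_scaleDr : right_distributive simple_scale +%R.
Proof. by move=> a x y; rewrite /simple_scale mulrDr. Qed.
Fact simple_scaleDl x : {morph simple_scale^~ x : a b / a + b}.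
Proof. by move=> a b; rewrite /simple_scale rmorphD mulrDl. Qed.

HB.instance Definition _ := GRing.Zmodule_isLmodule.Build A S
  simple_scaleA simple_scale1 simple_scaleDr simple_scaleDl.

Definition simple_module : lmodType A := S.
End SimpleModule.

(** * The opposite algebra *)

Section OppositeFrame.
Variables (K : fieldType) (A : algebra K) (n : nat) (E : elementary A n).

Definition op_aug_fun j : op A -> K := aug E j.

Fact op_aug_zmod j : zmod_morphism (op_aug_fun j).
Proof. exact: (raddfB (aug E j)). Qed.

Fact op_aug_monoid j : monoid_morphism (op_aug_fun j).
Proof.
split; first exact: (rmorph1 (aug E j)).
by move=> x y; rewrite mulrC; apply: (rmorphM (aug E j)).
Qed.

Definition op_aug j : {rmorphism op A -> K} :=
  HB.pack (op_aug_fun j)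
    (GRing.isZmodMorphism.Build (op A) K (op_aug_fun j) (op_aug_zmod j))
    (GRing.isMonoidMorphism.Build (op A) K (op_aug_fun j) (op_aug_monoid j)).

Fact op_idemM (j k : 'I_n) :
  (idem E j : op A) * (idem E k : op A) = if j == k then idem E j else 0.
Proof.
rewrite -[LHS]/(idem E k * idem E j : A) idemM eq_sym.
by case: eqP => // ->.
Qed.

Lemma op_prod (vs : seq A) :
  \prod_(x <- vs) (x : op A) = \prod_(x <- rev vs) x :> A.
Proof.
elim: vs => [|x vs IH]; first by rewrite !big_nil.
by rewrite big_cons rev_cons -cats1 big_cat big_seq1 IH.
Qed.

Fact op_aug_nilp : exists N, forall vs : seq (op A),
  size vs = N -> (forall x, x \in vs -> forall j, op_aug j x = 0) ->
  \prod_(x <- vs) x = 0.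
Proof.
have [N nil] := aug_nilp E; exists N => vs sz rv; rewrite op_prod nil //.
  by rewrite size_rev.
by move=> x; rewrite mem_rev; apply: rv.
Qed.

Definition op_elementary : elementary (op A) n :=
  @Elementary K (op A) n (idem E) op_aug op_idemM (idem_sum E)
    (aug_scalar E) (aug_idem E) op_aug_nilp.

Definition op_preproj_vertex i (F : preproj_vertex E i) :
  preproj_vertex op_elementary i :=
  @PreprojVertex K (op A) n op_elementary i (nbr F) (nbr0 F) (@nbrv _ _ _ _ _ F)
    (@out _ _ _ _ _ F) (@inn _ _ _ _ _ F) (@nbrv_neq _ _ _ _ _ F)
    (@out_r _ _ _ _ _ F) (@out_l _ _ _ _ _ F)
    (@inn_r _ _ _ _ _ F) (@inn_l _ _ _ _ _ F)
    (out_inn F) (out_gen F) (inn_gen F)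
    (@out_exact _ _ _ _ _ F) (@inn_exact _ _ _ _ _ F).

End OppositeFrame.

(** * The Auslander-Reiten translate of the vertex ideal *)

Section TauRigid.
Variables (K : fieldType) (A : algebra K) (n : nat) (E : elementary A n).
Variables (i : 'I_n) (F : preproj_vertex E i) (I : ideal A).
Hypothesis I_mem : forall x, (x \in I) = (aug E i x == 0).
Local Notation e := (idem E).
Local Notation T0 := ('I_n + nbr F)%type.

(* [gen0] lists generators of [I] and [cut0] the idempotents fixing them on the
   left.  The index [inl i] carries the zero idempotent: it stands for no
   generator. *)
Let off (j : 'I_n) : A := if j == i then 0 else e j.
Let cut0 (t : T0) : A := match t with inl j => off j | inr b => e (nbrv b) end.
Let gen0 (t : T0) : A := match t with inl j => off j | inr b => inn b end.
Let rel1 (t : T0) : A := match t with inl j => 0 | inr b => out b end.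
Let cut1 (t : unit) : A := e i.

Fact cut0K t : cut0 t * cut0 t = cut0 t.
Proof.
case: t => [j|b] /=; last by rewrite idemK.
by rewrite /off; case: eqP; rewrite ?mul0r ?idemK.
Qed.

Fact cut1K t : cut1 t * cut1 t = cut1 t.
Proof. exact: idemK. Qed.

Fact cut_gen0 t : cut0 t * gen0 t = gen0 t.
Proof.
case: t => [j|b] /=; last by rewrite inn_l.
exact: (cut0K (inl j)).
Qed.

Fact rel1_cut t : rel1 t * cut0 t = rel1 t.
Proof. by case: t => [j|b] /=; rewrite ?mul0r ?out_r. Qed.

Fact aug_cut0 t : aug E i (cut0 t) = 0.
Proof.
case: t => [j|b] /=; last by rewrite aug_idem eq_sym (negPf (nbrv_neq b)).
by rewrite /off; case: eqVneq => [_|ji];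
  rewrite ?rmorph0 // aug_idem eq_sym (negPf ji).
Qed.

Fact gen0_mem t : gen0 t \in I.
Proof. by rewrite I_mem -cut_gen0 rmorphM aug_cut0 mul0r. Qed.

Local Notation P0 := (projsum cut0).
Local Notation P1 := (projsum cut1).
Local Notation X := (ideal_module I).

Definition cover0 : {linear P0 -> X} :=
  projsum_map cut0 (fun t => ideal_sub (gen0_mem t)).

Definition cover1 : {linear P1 -> P0} :=
  projsum_map cut1 (fun _ => mk_projsum rel1_cut).

Lemma cover0E u : val (cover0 u) = \sum_t coord u t * gen0 t.
Proof. exact: (linear_sum (ideal_incl I)). Qed.

Lemma sum_unit (V : zmodType) (f : unit -> V) : \sum_t f t = f tt.
Proof. by rewrite (bigD1 tt) //= big1 ?addr0 // => -[]. Qed.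

Lemma cover1E u t : coord (cover1 u) t = coord u tt * rel1 t.
Proof.
by rewrite projsum_mapE sum_unit coordZ mk_coord.
Qed.

Lemma cover0_surj : surjective cover0.
Proof.
move=> x; have [z [xE _]] := vertex_ideal_decomp F I_mem (valP x).
pose y (t : T0) : A := match t with
  | inl j => if j == i then 0 else (val x : A) * e j
  | inr b => z b * e (nbrv b) end.
have yP t : y t * cut0 t = y t.
  case: t => [j|b] /=; last by rewrite -mulrA idemK.
  by rewrite /off; case: eqP; rewrite ?mul0r // -mulrA idemK.
exists (mk_projsum yP); apply: val_inj; rewrite cover0E big_sumType [RHS]xE.
congr (_ + _); last first.
  by apply: eq_bigr => b _; rewrite mk_coord -mulrA inn_l.
rewrite [RHS]big_mkcond; apply: eq_bigr => j _; rewrite mk_coord /= /off.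
by case: eqP; rewrite ?mul0r // -mulrA idemK.
Qed.

(** Right multiplication by [e j], [j != i], kills all generators but one, so
    the coordinates at [inl j] of a kernel element vanish; for the others this
    is [inn_exact]. *)
Lemma cover_exact y : cover0 y = 0 <-> exists x, cover1 x = y.
Proof.
split=> [y0|[x <-]]; last first.
  apply: val_inj; rewrite cover0E (eq_bigr _ (fun t _ => congr1 ( *%R^~ _)
    (cover1E x t))).
  rewrite (eq_bigr _ (fun t _ => esym (mulrA _ _ _))) -mulr_sumr big_sumType /=.
  by rewrite out_inn addr0 big1 ?mulr0 // => j _; rewrite mul0r.
have S0 : \sum_t coord y t * gen0 t = 0 by rewrite -cover0E y0.
have yl j : coord y (inl j) = 0.
  rewrite -(projsum_cut y) /= /off; case: eqVneq => [_|ji];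
    first by rewrite mulr0.
  have := congr1 ( *%R^~ (e j)) S0; rewrite mul0r mulr_suml (bigD1 (inl j)) //=.
  rewrite /off (negPf ji) -mulrA idemK big1 ?addr0 // => -[k|b] /= kj.
    rewrite /off; case: (k == i);
      rewrite ?mulr0 ?mul0r // -mulrA idem_ortho ?mulr0 //.
  by rewrite -mulrA -[inn b]inn_r -(mulrA (inn b)) idem_ortho ?mulr0 // eq_sym.
have [||a ya] := inn_exact (x := fun b : nbr F => coord y (inr b)).
- by move=> b; apply: (projsum_cut y (inr b)).
- move: S0; rewrite big_sumType /= big1 ?add0r // => j _.
  by rewrite yl mul0r.
have aP t : a * e i * cut1 t = a * e i by rewrite -mulrA idemK.
exists (mk_projsum aP); apply: coord_inj => t; rewrite cover1E mk_coord.
case: t => [j|b] /=; first by rewrite mulr0 yl.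
by rewrite -mulrA out_l ya.
Qed.

Lemma cover0_superfluous : superfluous_ker cover0.
Proof.
apply: (projsum_superfluous (E := E) cut0K) => u /cover_exact[x <-] t j.
rewrite cover1E rmorphM; case: t => [k|b] /=; first by rewrite rmorph0 mulr0.
by rewrite aug_out mulr0.
Qed.

(** A kernel element [a] satisfies [a * out b = 0]; if it were not radical, it
    would be invertible in the corner at [i], and [out b] would be zero. *)
Lemma cover1_superfluous : superfluous_ker cover1.
Proof.
apply: (projsum_superfluous (E := E) cut1K) => u u0 [] j; set a := coord u tt.
have ae : a * e i = a := projsum_cut u tt.
case: (eqVneq j i) => [->|ji]; last exact: (aug_off ae ji).
apply/eqP/negPn/negP => nz; apply: (@out_neq0 _ _ _ _ _ F (nbr0 F)).
have a0 : a * out (nbr0 F) = 0.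
  have := cover1E u (inr (nbr0 F)); rewrite u0 => <-.
  by rewrite /coord linear0 ffunE.
have [||| w [_ wa]] := @corner_unit _ _ _ E i (e i * a).
- by rewrite mulrA idemK.
- by rewrite -mulrA ae.
- by rewrite rmorphM aug_idem eqxx mul1r.
by rewrite -(out_l (nbr0 F)) -wa -!mulrA a0 !mulr0.
Qed.

Lemma min_presentation : min_proj_presentation cover1 cover0.
Proof.
split; [split; apply: projsum_projective; [exact: cut1K|exact: cut0K]|split| |].
- exact: cover0_surj.
- exact: cover0_superfluous.
- exact: cover_exact.
- exact: cover1_superfluous.
Qed.

Local Notation top1 := (projsum_basis cut1K tt).

(** A homomorphism [P1 -> A] is determined by an element of [e i * A], and it
    factors through [cover1] when this element lies in the right ideal spanned
    by the [out b], which by [out_gen] is the kernel of [aug E i] on [e i *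
    A]. *)
Lemma transpose_simple :
  is_transpose cover1 (simple_module (op_aug E i)).
Proof.
have topE : e i *: top1 = top1.
  apply: coord_inj => t; rewrite coordZ mk_coord.
  by case: t; rewrite idemK.
have val1 (f : {linear P1 -> A^o}) x : f x = coord x tt * f top1.
  by rewrite (projsum_linE cut1K) sum_unit.
exists (fun f => aug E i (f top1)); split.
- by move=> f g h hfg; rewrite hfg rmorphD.
- by move=> a f g gf; rewrite gf rmorphM mulrC.
- move=> m; exists (projsum_map cut1 (fun _ => @alg_scalar K A m * e i : A^o)).
  rewrite projsum_mapE sum_unit mk_coord /= rmorphM rmorphM aug_scalar.
  by rewrite aug_idem eqxx mulr1 mul1r.
- move=> f; split=> [f0|[h fh]]; last first.
    rewrite fh (projsum_linE cut0K) rmorph_sum big1 // => t _.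
    rewrite cover1E /= rmorphM rmorphM; case: t => [k|b] /=.
      by rewrite rmorph0 mulr0 mul0r.
    by rewrite aug_out mulr0 mul0r.
  have ef : e i * f top1 = f top1 by rewrite -[in RHS]topE linearZ.
  have [z fz] := out_gen F ef f0.
  exists (projsum_map cut0 (fun t => match t return A^o with inl _ => 0 |
    inr b => z b end)).
  move=> x; rewrite val1 projsum_mapE big_sumType /= big1 ?add0r; last first.
    by move=> j _; rewrite cover1E mulr0 scale0r.
  by rewrite fz mulr_sumr; apply: eq_bigr => b _; rewrite cover1E /= mulrA.
Qed.

Lemma dual_simple :
  is_dual (simple_module (op_aug E i)) (simple_module (aug E i)).
Proof.
exists (fun t m => (t : K) * (m : K)); split.
- move=> t; split=> [x y|c x]; first exact: mulrDr.
  rewrite -[_ *: x]/(aug E i (@alg_scalar K A c) * (x : K)) aug_scalar.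
  by rewrite mulrCA.
- by move=> t u m; apply: mulrDl.
- move=> a t m; rewrite -[_ *: m]/(aug E i a * (m :
  K)) -[_ *: t]/(aug E i a * (t : K)).
  by rewrite mulrCA mulrA.
- by move=> t u /(_ (1 : K)); rewrite !mulr1.
- move=> phi [_ phiZ]; exists (phi (1 : K)) => m.
  rewrite mulrC -phiZ; congr phi.
  by rewrite -[_ *: _]/(aug E i (@alg_scalar K A m) * (1 : K)) aug_scalar mulr1.
Qed.

Lemma vertex_ideal_tau_rigid : tau_rigid X.
Proof.
split.
  exists #|{: T0}|, (fun k => ideal_sub (gen0_mem (enum_val k))) => x.
  have [y <-] := cover0_surj x; exists (fun k => coord y (enum_val k)).
  by rewrite projsum_mapE big_enum_val.
exists (simple_module (aug E i)); split=> [|f x].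
  exists P1, P0, cover1, cover0, (simple_module (op_aug E i)); split.
  - exact: min_presentation.
  - exact: transpose_simple.
  - exact: dual_simple.
have [y <-] := cover0_surj x; rewrite projsum_mapE linear_sum big1 // => t _.
rewrite linearZ /=.
have -> : f (ideal_sub (gen0_mem t)) = 0; last exact: scaler0.
have -> : ideal_sub (gen0_mem t) = cut0 t *: ideal_sub (gen0_mem t).
  by apply: val_inj; rewrite /= -[RHS]/(cut0 t * gen0 t) cut_gen0.
by rewrite linearZ /= -[LHS]/(aug E i (cut0 t) * _) aug_cut0 mul0r.
Qed.

Lemma vertex_ideal_tau_tilting : tau_tilting X.
Proof.
split; first exact: vertex_ideal_tau_rigid.
exists n; split; first exact: (vertex_ideal_num_ind_summands F I_mem).
exact: (regular_num_ind_summands E).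
Qed.

End TauRigid.

(** * Support tau-tilting modules *)

Section Transport.
Variables (K : fieldType) (A B : algebra K) (phi : {rmorphism A -> B})
  (psi : B -> A).
Hypotheses (phiK : cancel phi psi) (psiK : cancel psi phi).
Hypothesis phi_scalar : forall c, phi (@alg_scalar K A c) = @alg_scalar K B c.
Variables (n : nat) (E : elementary A n).

Let phiI := can_inj phiK.

Fact psi_zmod : zmod_morphism psi.
Proof. by move=> x y; apply: phiI; rewrite rmorphB !psiK. Qed.

Fact psi_monoid : monoid_morphism psi.
Proof.
by split=> [|x y]; apply: phiI; rewrite ?rmorphM ?rmorph1 !psiK.
Qed.

Definition psi_morph : {rmorphism B -> A} := HB.pack psi
  (GRing.isZmodMorphism.Build B A psi psi_zmod)
  (GRing.isMonoidMorphism.Build B A psi psi_monoid).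

Definition iso_aug j : {rmorphism B -> K} :=
  (aug E j \o psi_morph : {rmorphism B -> K}).

Definition iso_elementary : elementary B n.
Proof.
apply: (@Elementary K B n (fun j => phi (idem E j)) iso_aug).
- by move=> j k; rewrite -rmorphM idemM; case: eqP; rewrite ?rmorph0.
- by rewrite -rmorph_sum idem_sum rmorph1.
- by move=> j c /=; rewrite -phi_scalar phiK aug_scalar.
- by move=> j k /=; rewrite phiK aug_idem.
- have [N nil] := aug_nilp E; exists N => vs sz rv.
  rewrite -[LHS]psiK -[psi _]/(psi_morph _)
    rmorph_prod /= -(big_map psi xpredT id).
  rewrite nil ?size_map ?rmorph0 // => _ /mapP[y /rv ry ->]; exact: ry.
Defined.

Lemma iso_preproj_vertex i (F : preproj_vertex E i) :
  preproj_vertex iso_elementary i.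
Proof.
have hsum (T : finType) (f g : T -> B) :
    psi (\sum_t f t * g t) = \sum_t psi (f t) * psi (g t).
  by rewrite -[psi _]/(psi_morph _) rmorph_sum; apply: eq_bigr => t _;
    rewrite rmorphM.
apply: (@PreprojVertex K B n iso_elementary i (nbr F) (nbr0 F)
  (@nbrv _ _ _ _ _ F) (fun b => phi (inn b)) (fun b => phi (out b))).
- exact: nbrv_neq.
- by move=> b; rewrite -rmorphM inn_l.
- by move=> b; rewrite -rmorphM inn_r.
- by move=> b; rewrite -rmorphM out_l.
- by move=> b; rewrite -rmorphM out_r.
- rewrite (eq_bigr (fun b : nbr F => phi (out b * inn b))) => [|b _].
    by rewrite -rmorph_sum out_inn rmorph0.
  by rewrite rmorphM.
- move=> x xe x0; have [||y xy] := inn_gen F (x := psi x) => //.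
    by rewrite -[in RHS]xe (psi_monoid.2) phiK.
  exists (fun b => phi (y b)); rewrite -[x]psiK xy rmorph_sum.
  by apply: eq_bigr => b _; rewrite rmorphM.
- move=> x xe x0; have [||y xy] := out_gen F (x := psi x) => //.
    by rewrite -[in RHS]xe (psi_monoid.2) phiK.
  exists (fun b => phi (y b)); rewrite -[x]psiK xy rmorph_sum.
  by apply: eq_bigr => b _; rewrite rmorphM.
- move=> x xe x0; have [||a xa] := inn_exact (x := fun b : nbr F => psi (x b)).
  + by move=> b; rewrite -[in RHS]xe (psi_monoid.2) phiK.
  + have := congr1 psi x0; rewrite hsum -[psi 0]/(psi_morph 0) rmorph0 => psi0.
    by apply: etrans psi0; apply: eq_bigr => b _; rewrite phiK.
  by exists (phi a) => b; rewrite -[x b]psiK xa rmorphM.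
- move=> x xe x0; have [||a xa] := out_exact (x := fun b : nbr F => psi (x b)).
  + by move=> b; rewrite -[in RHS]xe (psi_monoid.2) phiK.
  + have := congr1 psi x0; rewrite hsum -[psi 0]/(psi_morph 0) rmorph0 => psi0.
    by apply: etrans psi0; apply: eq_bigr => b _; rewrite phiK.
  by exists (phi a) => b; rewrite -[x b]psiK xa rmorphM.
Qed.

End Transport.

Section Quotients.
Variables (A : pzRingType) (I : ideal A).

Lemma quotient_reprK : cancel repr (quotient_map I).
Proof. exact: reprK. Qed.

Lemma quotient_map_eq x y :
  (quotient_map I x == quotient_map I y) = (x - y \in I).
Proof. by rewrite Quotient.idealrBE. Qed.

Lemma quotient_map_eq0 x : (quotient_map I x == 0) = (x \in I).
Proof. by rewrite -(rmorph0 (quotient_map I)) quotient_map_eq subr0. Qed.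
End Quotients.

Section AugIdeal.
Variables (K : fieldType) (A : algebra K) (chi : {rmorphism A -> K}).

Definition aug_ker : {pred A} := fun x => chi x == 0.

Fact aug_ker_zmod : zmod_closed aug_ker.
Proof.
split=> [|x y /eqP x0 /eqP y0]; apply/eqP; first exact: rmorph0.
by rewrite rmorphB x0 y0 subrr.
Qed.

Fact aug_ker_mull a x : x \in aug_ker -> a * x \in aug_ker.
Proof. by move=> /eqP x0; apply/eqP; rewrite rmorphM x0 mulr0. Qed.

Fact aug_ker_mulr a x : x \in aug_ker -> x * a \in aug_ker.
Proof. by move=> /eqP x0; apply/eqP; rewrite rmorphM x0 mul0r. Qed.

Definition aug_ideal : ideal A := Ideal aug_ker_zmod aug_ker_mull aug_ker_mulr.
End AugIdeal.

Section Support.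
Variable K : fieldType.

Section Sincere.
Variables (A : algebra K) (n : nat) (E : elementary A n).
Variables (i : 'I_n) (F : preproj_vertex E i) (I : ideal A).
Hypothesis I_mem : forall x, (x \in I) = (aug E i x == 0).

Local Notation Z := (principal_ideal (0 : A)).

Lemma principal0 x : (x \in Z) = (x == 0).
Proof.
apply/idP/eqP => [/asboolP[m [a [b ->]]]|->]; last exact: rpred0.
by rewrite big1 // => k _; rewrite mulr0 mul0r.
Qed.

Let phi : {rmorphism A -> quotient_algebra Z} := quotient_map Z.

Lemma quotient0K : cancel phi repr.
Proof.
move=> x; apply/eqP; rewrite -subr_eq0 -principal0 -quotient_map_eq.
by rewrite quotient_reprK.
Qed.

(** The idempotent is zero; the quotient by the zero ideal is another ring than
    [A], and the structure has to be carried over to it. *)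
Lemma support_tau_tilting_vertex : support_tau_tilting (ideal_module I).
Proof.
exists 0; split; first exact: mulr0.
pose E' := iso_elementary quotient0K (@quotient_reprK A Z) (fun=> erefl) E.
have F' : preproj_vertex E' i by apply: iso_preproj_vertex.
pose J := aug_ideal (aug E' i).
have J_mem x : (x \in J) = (aug E' i x == 0) by [].
have phiJ x : x \in I -> phi x \in J by rewrite J_mem I_mem /= quotient0K.
have psiI y : y \in J -> repr y \in I by rewrite J_mem I_mem.
exists (ideal_module J), (fun u => ideal_sub (phiJ _ (valP u))); split.
- exact: (vertex_ideal_tau_tilting F' J_mem).
- exists (fun v => ideal_sub (psiI _ (valP v))) => u; apply: val_inj => /=.
    exact: quotient0K.
  exact: quotient_reprK.
- by move=> x y; apply: val_inj; rewrite /= rmorphD.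
- by move=> a x; apply: val_inj; rewrite /= rmorphM.
Qed.
End Sincere.

Lemma tau_tilting_trivial (A : algebra K) (X : lmodType A) :
  (1 : A) = 0 -> tau_tilting X.
Proof.
move=> triv.
have M0 (M : lmodType A) (x : M) : x = 0 by rewrite -[x]scale1r triv scale0r.
have N0 (M : lmodType (op A)) (x : M) : x = 0.
  by rewrite -[x]scale1r -[1]/(1 : A) triv scale0r.
have S0 (M N : lmodType A) (f : {linear M -> N}) : surjective f.
  by move=> u; exists 0; rewrite [RHS]M0 [LHS]M0.
have P0 (M : lmodType A) : projective M.
  by move=> N N' g f _; exists \0 => x; rewrite [RHS]M0 [LHS]M0.
have num0 (M : lmodType A) : num_ind_summands M 0.
  exists (fun _ => M); split=> [[]|[]|Y [nz _] _] //.
  by case: nz => y; apply: M0.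
split; last by exists 0%N; split; exact: num0.
split.
  by exists 0%N, (fun=> 0) => x; exists (fun=> 0); rewrite big_ord0 [LHS]M0.
exists X; split; last by move=> f x; rewrite [LHS]M0.
exists X, X, idfun, idfun, ((op A)^o : lmodType (op A)); split.
- split; [by split; apply: P0| |by move=> y; split=> _; [exists y|exact: M0]|].
    by split=> [|N h _]; apply: S0.
  by move=> N h _; apply: S0.
- exists (fun=> 0); split.
  + by move=> f g h _; apply/esym/addr0.
  + by move=> a f g _; apply/esym/scaler0.
  + by move=> y; exists \0; rewrite [RHS]N0.
  + by move=> f; split=> // _; exists f.
- exists (fun _ _ => 0); split.
  + by move=> _; split=> *; rewrite ?addr0 ?mulr0.
  + by move=> t u m; rewrite addr0.
  + by [].
  + by move=> t u _; rewrite [t]M0 [RHS]M0.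
  + move=> phi [phiD _]; exists 0 => m; rewrite [m]N0.
    by apply: (addrI (phi 0)); rewrite -phiD !addr0.
Qed.

Lemma support_tau_tilting_zero (A : algebra K) (X : lmodType A) :
  zero_mod X -> support_tau_tilting X.
Proof.
move=> X0; exists 1; split; first exact: mulr1.
have triv : (1 : quotient_algebra (principal_ideal (1 : A))) = 0.
  rewrite -(rmorph1 (quotient_map (principal_ideal (1 : A)))).
  apply/eqP; rewrite quotient_map_eq0; apply/asboolP.
  by exists 1%N, (fun=> 1), (fun=> 1); rewrite big_ord1 !mulr1.
have Q0 (y : quotient_algebra (principal_ideal (1 : A))) : y = 0.
  by rewrite -[y]mulr1 triv mulr0.
exists ((quotient_algebra (principal_ideal (1 : A)))^o : lmodType _), (fun=> 0).
split; first exact: tau_tilting_trivial.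
- by exists (fun=> 0) => x; rewrite ?[RHS]X0 // [RHS]Q0.
- by move=> *; rewrite addr0.
- by move=> *; rewrite scaler0.
Qed.

Lemma basic_zero (A : pzRingType) (X : lmodType A) : zero_mod X -> basic X.
Proof.
move=> X0; exists 0%N, (fun=> X); split=> [[]|[]|] //.
exists (fun=> idfun), (fun=> idfun); split=> [[]|[]|x] //.
by rewrite big_ord0 [LHS]X0.
Qed.

End Support.

(** * Path algebras and Fox derivatives *)

Section PathBasis.
Variables (K : fieldType) (V : finType) (R : quiver V).
Local Notation path := (qpath R).
Local Notation triv := (@trivial_path V R).

(** The properties of a path algebra that are used below: a basis [pelt] of
    paths with its coordinates, and the linear extension of maps from this
    basis.  They are all that is needed of the representation by finitely
    supported functions. *)
Record path_basis (A : algebra K) := PathBasis {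
  pelt : path -> A;
  pcoef : path -> A -> K;
  lin_ext : (path -> A) -> A -> A;
  pcoefB : forall p f g, pcoef p (f - g) = pcoef p f - pcoef p g;
  pcoefZ : forall p c f, pcoef p (@alg_scalar K A c * f) = c * pcoef p f;
  pcoefU : forall p q, pcoef p (pelt q) = (q == p)%:R;
  pelt_ind : forall P : A -> Prop, P 0 ->
    (forall x y, P x -> P y -> P (x + y)) ->
    (forall c p, P (@alg_scalar K A c * pelt p)) -> forall f, P f;
  peltM : forall p q, pelt p * pelt q =
    if path_cat p q is Some s then pelt s else 0;
  pelt1 : 1 = \sum_v pelt (triv v);
  lin_extD : forall phi f g,
    lin_ext phi (f + g) = lin_ext phi f + lin_ext phi g;
  lin_extZ : forall phi c f,
    lin_ext phi (@alg_scalar K A c * f) = @alg_scalar K A c * lin_ext phi f;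
  lin_extU : forall phi p, lin_ext phi (pelt p) = phi p
}.

End PathBasis.

Section Instance.
Variables (K : fieldType) (V : finType) (R : quiver V).
Local Notation path := (qpath R).
Local Notation KR := (path_algebra K R).
Local Notation car := (path_algebra_car K R).
Local Notation sc := (@alg_scalar K KR).

Let coef (p : path) (f : KR) : K := (f : car)@_p.

Fact coefD p f g : coef p (f + g) = coef p f + coef p g.
Proof. exact: mcoeffD. Qed.

Fact coefZ p c f : coef p (sc c * f) = c * coef p f.
Proof. by rewrite /coef [sc c * f]pathalg_scalarM mcoeffZ. Qed.

Fact scale_path c (p : path) : sc c * path_elt K p = (<< c *g p >> : car).
Proof. by rewrite [LHS]pathalg_scalarM [LHS]scale_pathU mulr1. Qed.

Fact path_elt_ind (P : KR -> Prop) : P 0 -> (forall x y,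
  P x -> P y -> P (x + y)) ->
  (forall c p, P (sc c * path_elt K p)) -> forall f, P f.
Proof.
move=> P0 PD PU f; rewrite [f]pathalgE.
elim/big_ind: _ => // p _; rewrite -scale_path; exact: PU.
Qed.

Fact path_eltM (p q : path) : path_elt K p * path_elt K q =
  if path_cat p q is Some s then path_elt K s else 0.
Proof.
by rewrite [LHS]pathalg_mulUU mulr1 scale1r /path_mul; case: path_cat.
Qed.

Let ext (phi : path -> KR) (f : KR) : KR :=
  \sum_(p <- msupp (f : car)) sc (coef p f) * phi p.

Fact extw phi (d : {fset path}) (f : KR) : (msupp (f : car) `<=` d)%fset ->
  ext phi f = \sum_(p <- d) sc (coef p f) * phi p.
Proof.
move=> le; apply: big_fset_incl => // p _ /mcoeff_outdom.
by rewrite /coef => ->; rewrite rmorph0 mul0r.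
Qed.

Fact extD phi f g : ext phi (f + g) = ext phi f + ext phi g.
Proof.
pose d := (msupp (f : car) `|` msupp (g : car))%fset.
rewrite (@extw phi d (f + g)) ?msuppD_le // (@extw phi d f) ?fsubsetUl //.
rewrite (@extw phi d g) ?fsubsetUr // -big_split; apply: eq_bigr => p _ /=.
by rewrite coefD rmorphD mulrDl.
Qed.

Fact extZ phi c f : ext phi (sc c * f) = sc c * ext phi f.
Proof.
rewrite (@extw phi (msupp (f : car)) (sc c * f)); last first.
  by rewrite [sc c * f]pathalg_scalarM msuppZ_le.
rewrite /ext [RHS]mulr_sumr; apply: eq_bigr => p _.
by rewrite coefZ rmorphM mulrA.
Qed.

Fact extU phi p : ext phi (path_elt K p) = phi p.
Proof.
rewrite (@extw phi [fset p]%fset) ?msuppU_le // big_seq_fset1.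
by rewrite [coef _ _]mcoeffUU rmorph1 mul1r.
Qed.

Definition path_algebra_basis : path_basis R KR :=
  @PathBasis K V R KR (@path_elt K V R) coef ext
    (fun p => @mcoeffB _ _ p) coefZ (fun p q => mcoeffU _ _ _)
    path_elt_ind path_eltM erefl extD extZ extU.

End Instance.

Section PathDecomposition.
Variables (V : finType) (R : quiver V).
Local Notation path := (qpath R).
Local Notation triv := (@trivial_path V R).

Lemma path_cat_trivE v (p q : path) : path_cat p q = Some (triv v) ->
  p = triv v /\ q = triv v.
Proof.
case/path_catP=> e; rewrite /triv /= => -[vE].
case: p q e vE => [[x s] ps] [[y t] pt];
  rewrite /path_tgt /path_src /path_arrows /=.
case: s ps => //= ps; case: t pt => //= pt xy vx; subst v y.
by split; apply: val_inj.
Qed.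

Lemma arrow_path_neq_triv (b : arrow R) v : arrow_path b != triv v.
Proof. by apply/eqP => /(congr1 (fun p => size (path_arrows p))). Qed.

Lemma path_catS (p q : path) : path_tgt p = path_src q -> exists r,
  path_cat p q = Some r.
Proof.
move=> e; have := path_catE p q; rewrite e eqxx; case: path_cat => // r _.
by exists r.
Qed.

Lemma path_lastP (p : path) : (exists v, p = triv v) \/
  (exists q b, path_cat q (arrow_path b) = Some p).
Proof.
case: p => [[v s] ps]; case: (lastP s) ps => [|s' b] ps.
  by left; exists v; apply: val_inj.
right; have ps2 : walk v (s' ++ [:: b]) by rewrite cats1.
move: ps2; rewrite walk_cat => /andP[ps' /=]; rewrite andbT => /eqP sb.
exists (exist _ (v, s') ps' : path), b; apply/path_catP; split.
  by rewrite /path_tgt /path_src /path_arrows /= -sb.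
by rewrite /= cats1.
Qed.

Lemma path_cat_arrow_inj (q q' p : path)
  (b b' : arrow R) : path_cat q (arrow_path b) = Some p ->
  path_cat q' (arrow_path b') = Some p -> q = q' /\ b = b'.
Proof.
case/path_catP=> _ pE; case/path_catP=> _; rewrite pE => -[e1] /=.
rewrite !cats1 => /eqP; rewrite eqseq_rcons => /andP[/eqP e2 /eqP e3].
split=> //; apply: val_inj; move: e1 e2; rewrite /path_src /path_arrows.
by case: (val q) (val q') => [? ?] [? ?] /= -> ->.
Qed.

End PathDecomposition.

Section PathAlgebraTheory.
Variables (K : fieldType) (V : finType) (R : quiver V).
Variables (KR : algebra K) (B : path_basis R KR).
Local Notation path := (qpath R).
Local Notation triv := (@trivial_path V R).
Local Notation sc := (@alg_scalar K KR).
Local Notation pelt := (pelt B).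
Local Notation pcoef := (pcoef B).

Lemma pcoef0 p : pcoef p 0 = 0.
Proof. by rewrite -(subrr 0) pcoefB subrr. Qed.

Lemma pcoefD p f g : pcoef p (f + g) = pcoef p f + pcoef p g.
Proof. by have := pcoefB B p (f + g) g; rewrite addrK => ->; rewrite subrK. Qed.

Lemma pcoef_sum p I (s : seq I) (P : pred I) (F : I -> KR) :
  pcoef p (\sum_(i <- s | P i) F i) = \sum_(i <- s | P i) pcoef p (F i).
Proof. exact: (big_morph (pcoef p) (pcoefD p) (pcoef0 p)). Qed.

Lemma lin_ext0 phi : lin_ext B phi 0 = 0.
Proof. by apply: (addrI (lin_ext B phi 0)); rewrite -lin_extD !addr0. Qed.

Lemma lin_ext_sum phi I (s : seq I) (P : pred I) (F : I -> KR) :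
  lin_ext B phi (\sum_(i <- s | P i) F i) = \sum_(i <- s |
    P i) lin_ext B phi (F i).
Proof. exact: (big_morph (lin_ext B phi) (lin_extD B phi) (lin_ext0 phi)). Qed.

Lemma lin_extB phi f g :
  lin_ext B phi (f - g) = lin_ext B phi f - lin_ext B phi g.
Proof. by have := lin_extD B phi (f - g) g; rewrite [f - g + g]subrK => ->;
  rewrite addrK. Qed.

Lemma lin_extN phi f : lin_ext B phi (- f) = - lin_ext B phi f.
Proof. by rewrite -[in LHS]sub0r lin_extB lin_ext0 sub0r. Qed.

Lemma lin_ext_sign phi (s : bool) f :
  lin_ext B phi ((-1) ^+ s * f) = (-1) ^+ s * lin_ext B phi f.
Proof. by case: s; rewrite ?mulN1r ?mul1r ?lin_extN. Qed.

Lemma pcoef_trivM v f g : pcoef (triv v)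
  (f * g) = pcoef (triv v) f * pcoef (triv v) g.
Proof.
elim/(@pelt_ind _ _ _ _ B): f => [|x y Hx Hy|c p];
  first by rewrite mul0r pcoef0 mul0r.
  by rewrite mulrDl !pcoefD Hx Hy mulrDl.
elim/(@pelt_ind _ _ _ _ B): g => [|x y Hx Hy|d q];
  first by rewrite mulr0 pcoef0 mulr0.
  by rewrite mulrDr !pcoefD Hx Hy mulrDr.
rewrite -!mulrA !pcoefZ -mulrA; congr (_ * _).
rewrite mulrA -alg_central -mulrA pcoefZ mulrCA; congr (_ * _).
rewrite peltM !pcoefU.
case: eqVneq => [->|np].
  rewrite mul1r path_cat_trivl; case: eqP => [e|ne]; first by rewrite pcoefU.
  by rewrite pcoef0; case: eqP => // qv; case: ne; rewrite qv.
rewrite mul0r; case epq: path_cat => [s|]; last exact: pcoef0.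
rewrite pcoefU; case: eqP => // sv; move: epq;
  rewrite sv => /path_cat_trivE[pv _].
by rewrite pv eqxx in np.
Qed.

Lemma pcoef_triv1 v : pcoef (triv v) 1 = 1.
Proof.
rewrite (pelt1 B) pcoef_sum (bigD1 v) //= pcoefU eqxx big1 ?addr0 // => w wv;
  rewrite pcoefU.
by case: eqP => // /(congr1 (@path_src _ _)) /eqP; rewrite (negPf wv).
Qed.

Fact pcoef_zmod p : zmod_morphism (pcoef p).
Proof. exact: pcoefB. Qed.

Fact pcoef_monoid v : monoid_morphism (pcoef (triv v)).
Proof. by split; [exact: pcoef_triv1|exact: pcoef_trivM]. Qed.

Definition path_aug v : {rmorphism KR -> K} := HB.pack (pcoef (triv v))
  (GRing.isZmodMorphism.Build KR K (pcoef (triv v)) (pcoef_zmod (triv v)))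
  (GRing.isMonoidMorphism.Build KR K (pcoef (triv v)) (pcoef_monoid v)).

Lemma path_augU v p : path_aug v (pelt p) = (p == triv v)%:R.
Proof. exact: pcoefU. Qed.

(** Removing a last arrow [b]; zero for paths that do not end with [b]. *)
Definition strip_path (b : arrow R) (p : path) : KR :=
  if (insub (path_src p,
    take (size (path_arrows p)).-1 (path_arrows p)) : option path)
    is Some q then
    if path_cat q (arrow_path b) == Some p then pelt q else 0
  else 0.

Lemma strip_path_cat b (q p : path) : path_cat q (arrow_path b) = Some p ->
  strip_path b p = pelt q.
Proof.
move=> e; have [_ pE] := (path_catP _ _ _).1 e.
have sE : path_src p = path_src q by rewrite {1}/path_src pE.
have aE : path_arrows p = path_arrows q ++ [:: b] by rewrite {1}/path_arrows pE.
rewrite /strip_path sE aE size_cat addn1 /= take_size_cat //.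
have -> : (path_src q, path_arrows q) = val q.
  by rewrite /path_src /path_arrows; case: (val q).
by rewrite valK e eqxx.
Qed.

Lemma strip_path_none b (p : path) : (forall q,
  path_cat q (arrow_path b) <> Some p) ->
  strip_path b p = 0.
Proof. by move=> H; rewrite /strip_path; case: insub => // q;
  case: eqP => // /H. Qed.

Lemma strip_path_triv b v : strip_path b (triv v) = 0.
Proof.
apply: strip_path_none => q /path_cat_trivE[_ /eqP].
by rewrite (negPf (arrow_path_neq_triv _ _)).
Qed.

Lemma strip_path_neq b c (q p : path) : path_cat q (arrow_path c) = Some p ->
  c != b ->
  strip_path b p = 0.
Proof.
move=> e cb; apply: strip_path_none => q' e'.
by have [_ bc] := path_cat_arrow_inj e e'; rewrite bc eqxx in cb.
Qed.

Definition fox b : KR -> KR := lin_ext B (strip_path b).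

(** The product rule of a derivation whose right action is the augmentation at
    the end of [b].  A path [g] is either trivial, and only the second term
    remains, or it has a last arrow, which is that of the product, and only the
    first term remains. *)
Lemma foxM b f g : fox b (f * g) =
  f * fox b g + fox b f * sc (path_aug (tgt b) g).
Proof.
elim/(@pelt_ind _ _ _ _ B): f => [|x y Hx Hy|c p].
- by rewrite !mul0r /fox lin_ext0 mul0r addr0.
- by rewrite !mulrDl /fox !lin_extD -/(fox b) Hx Hy mulrDl addrACA.
elim/(@pelt_ind _ _ _ _ B): g => [|x y Hx Hy|d q].
- by rewrite !mulr0 /fox lin_ext0 mulr0 rmorph0 rmorph0 mulr0 addr0.
- rewrite mulrDr /fox !lin_extD -/(fox b) Hx Hy rmorphD rmorphD !mulrDr.
  by rewrite addrACA.
have scCA e x y : x * (sc e * y) = sc e * (x * y).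
  by rewrite mulrA -alg_central -mulrA.
rewrite -mulrA scCA /fox !lin_extZ rmorphM -/(fox b).
have -> : path_aug (tgt b) (sc d) = d.
  by rewrite -[sc d]mulr1 [LHS]pcoefZ pcoef_triv1 mulr1.
rewrite -mulrA scCA rmorphM -[sc c * fox b _ * _]mulrA scCA -!mulrDr.
congr (_ * _); rewrite !scCA -mulrDr; congr (_ * _);
  rewrite /fox !lin_extU path_augU peltM.
have [[v ->]|[q' [e eq]]] := path_lastP q.
  rewrite strip_path_triv mulr0 add0r path_cat_trivr.
  have trivE : (triv v == triv (tgt b)) = (v == tgt b).
    by apply/eqP/eqP => [/(congr1 (@path_src _ _))|->].
  rewrite trivE.
  have [[w ->]|[p' [e ep]]] := path_lastP p.
    by case: eqP; rewrite ?lin_ext0 ?lin_extU strip_path_triv mul0r.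
  have tp : path_tgt p = tgt e := path_cat_tgt ep.
  case: (eqVneq e b) => [eb|ne]; last first.
    rewrite (strip_path_neq ep ne) mul0r.
    by case: eqP; rewrite ?lin_ext0 ?lin_extU // (strip_path_neq ep ne).
  rewrite tp eb [tgt b == v]eq_sym; case: eqP => _.
    by rewrite lin_extU rmorph1 mulr1.
  by rewrite lin_ext0 rmorph0 mulr0.
have nt : (q == triv (tgt b)) = false.
  apply/eqP => qv; move: eq; rewrite qv => /path_cat_trivE[_ /eqP].
  by rewrite (negPf (arrow_path_neq_triv _ _)).
rewrite nt rmorph0 mulr0 addr0.
have := path_catA p q' (arrow_path e); rewrite eq /=.
case epq: (path_cat p q') => [r|] /=; last first.
  move=> ->; rewrite lin_ext0; case: (eqVneq e b) => [eb|ne].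
    by rewrite eb in eq; rewrite (strip_path_cat eq) peltM epq.
  by rewrite (strip_path_neq eq ne) mulr0.
move=> ->; have te : path_tgt r = path_src (arrow_path e).
  by rewrite (path_cat_tgt epq); case/path_catP: eq.
have [s es] := path_catS te; rewrite es lin_extU.
case: (eqVneq e b) => [eb|ne].
  by rewrite eb in eq es;
    rewrite (strip_path_cat eq) (strip_path_cat es) peltM epq.
by rewrite (strip_path_neq eq ne) (strip_path_neq es ne) mulr0.
Qed.

Lemma fox_expand f : f = \sum_v sc (path_aug v f) * pelt (triv v) +
  \sum_b fox b f * pelt (arrow_path b).
Proof.
elim/(@pelt_ind _ _ _ _ B): f => [|x y Hx Hy|c p].
- rewrite !big1 ?addr0 // => [b _|v _]; first by rewrite /fox lin_ext0 mul0r.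
  by rewrite !rmorph0 mul0r.
- rewrite {1}Hx {1}Hy addrACA -!big_split; congr (_ + _);
  apply: eq_bigr => b _ /=.
    by rewrite pcoefD rmorphD mulrDl.
  by rewrite /fox lin_extD mulrDl.
rewrite (eq_bigr (fun v => sc c * (sc (path_aug v (pelt p)) * pelt (triv v))));
  last first.
  by move=> v _; rewrite [path_aug v (_ * _)]pcoefZ rmorphM mulrA.
rewrite (eq_bigr (fun b => sc c * (fox b (pelt p) * pelt (arrow_path b))));
  last first.
  by move=> b _; rewrite /fox lin_extZ mulrA.
rewrite -!mulr_sumr -mulrDr; congr (_ * _).
have [[v ->]|[q [e eq]]] := path_lastP p.
  rewrite [X in _ + X]big1 ?addr0 => [|b _];
    last by rewrite /fox lin_extU strip_path_triv mul0r.
  rewrite (bigD1 v) // path_augU eqxx rmorph1 mul1r big1 => [|w wv];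
    first exact/esym/addr0.
  rewrite path_augU; case: eqP => [/(congr1 (@path_src _ _))/esym/eqP|_].
    by rewrite (negPf wv).
  by rewrite rmorph0 mul0r.
rewrite big1 ?add0r => [|v _].
  rewrite (bigD1 e) //= /fox lin_extU (strip_path_cat eq) peltM eq.
  by rewrite big1 ?addr0 // => b be;
    rewrite lin_extU (strip_path_neq eq) ?mul0r // eq_sym.
rewrite path_augU; case: eqP => [pv|_]; last by rewrite rmorph0 mul0r.
move: eq; rewrite pv => /path_cat_trivE[_ /eqP].
by rewrite (negPf (arrow_path_neq_triv _ _)).
Qed.

End PathAlgebraTheory.

(** * Reversal of paths *)

Section Reversal.
Variables (V : finType) (Q : quiver V).
Local Notation R := (double_quiver Q).

Definition star (b : arrow R) : arrow R :=
  match b with inl a => inr a | inr a => inl a end.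

Definition is_star (b : arrow R) : bool := if b is inr _ then true else false.

Lemma starK : involutive star. Proof. by case. Qed.
Lemma src_star b : src (star b) = tgt b. Proof. by case: b. Qed.
Lemma tgt_star b : tgt (star b) = src b. Proof. by case: b. Qed.
Lemma is_starN b : is_star (star b) = ~~ is_star b. Proof. by case: b. Qed.

Definition rev_arrows (s : seq (arrow R)) := rev (map star s).

(** Both claims are needed for the induction: a reversed walk is a walk, and it
    ends where the walk started. *)
Lemma rev_walk v s : walk v s ->
  walk (walk_end v s) (rev_arrows s) && (walk_end (walk_end v s)
    (rev_arrows s) == v).
Proof.
elim: s v => [|b s IH] v; first by rewrite /= eqxx.
rewrite -[walk v _]/((src b == v) && walk (tgt b) s)
  => /andP[/eqP sb /IH/andP[ws we]].
have -> : rev_arrows (b :: s) = rev_arrows s ++ [:: star b].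
  by rewrite /rev_arrows /= rev_cons cats1.
have -> : walk_end v (b :: s) = walk_end (tgt b) s by [].
have -> : walk (walk_end (tgt b) s) (rev_arrows s ++ [:: star b]).
  rewrite walk_cat ws (eqP we) /=; have := walk_arrow (star b).
  by rewrite src_star.
by rewrite /walk_end map_cat last_cat -[last _ _]/(tgt (star b))
  tgt_star sb eqxx.
Qed.

Definition rev_path (p : qpath R) : qpath R :=
  exist _ (path_tgt p, rev_arrows (path_arrows p))
    (proj1 (andP (rev_walk (valP p : walk (path_src p) (path_arrows p))))).

Lemma rev_path_src p : path_src (rev_path p) = path_tgt p.
Proof. by []. Qed.

Lemma rev_path_tgt p : path_tgt (rev_path p) = path_src p.
Proof.
by have /andP[_ /eqP] := rev_walk (valP p : walk (path_src p) (path_arrows p)).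
Qed.

Lemma rev_pathK : involutive rev_path.
Proof.
move=> p; apply: val_inj; rewrite /= rev_path_tgt.
rewrite /rev_arrows map_rev revK -map_comp map_id_in; last by move=> b _;
  apply: starK.
by case: p => -[].
Qed.

Lemma rev_path_triv v : rev_path (trivial_path R v) = trivial_path R v.
Proof. exact: val_inj. Qed.

Lemma rev_path_arrow b : rev_path (arrow_path b) = arrow_path (star b).
Proof. by apply: val_inj; case: b. Qed.

Lemma rev_path_cat p q : path_cat (rev_path q) (rev_path p) =
  omap rev_path (path_cat p q).
Proof.
apply: (inj_omap val_inj); rewrite path_catE rev_path_tgt rev_path_src eq_sym.
case epq: (path_cat p q) => [s|] /=; last first.
  by have := path_catE p q; rewrite epq; case: eqP.
have [e sE] := (path_catP _ _ _).1 epq; rewrite e eqxx.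
rewrite (path_cat_tgt epq) -rev_path_src; congr (Some (_, _)).
by rewrite {3}/path_arrows sE /rev_arrows map_cat rev_cat.
Qed.

End Reversal.

Section PathReversal.
Variables (K : fieldType) (V : finType) (Q : quiver V).
Local Notation R := (double_quiver Q).
Variables (KR : algebra K) (B : path_basis R KR).
Local Notation sc := (@alg_scalar K KR).

Definition flip : KR -> KR := lin_ext B (fun p => pelt B (rev_path p)).

Lemma flipU p : flip (pelt B p) = pelt B (rev_path p).
Proof. exact: lin_extU. Qed.

Lemma flipM f g : flip (f * g) = flip g * flip f.
Proof.
elim/(@pelt_ind _ _ _ _ B): f => [|x y Hx Hy|c p].
- by rewrite mul0r /flip lin_ext0 mulr0.
- by rewrite mulrDl /flip !lin_extD -/flip Hx Hy mulrDr.
elim/(@pelt_ind _ _ _ _ B): g => [|x y Hx Hy|d q].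
- by rewrite mulr0 /flip lin_ext0 mul0r.
- by rewrite mulrDr /flip !lin_extD -/flip Hx Hy mulrDl.
have scCA e x y : x * (sc e * y) = sc e * (x * y).
  by rewrite mulrA -alg_central -mulrA.
rewrite -mulrA scCA /flip !lin_extZ -/flip [RHS]scCA -mulrA;
  congr (_ * (_ * _)).
rewrite !flipU !peltM rev_path_cat; case: path_cat => [s|] /=;
  first exact: flipU.
exact: lin_ext0.
Qed.

Lemma flipK : involutive flip.
Proof.
move=> f; elim/(@pelt_ind _ _ _ _ B): f => [|x y Hx Hy|c p].
- by rewrite /flip !lin_ext0.
- by rewrite /flip !lin_extD -/flip Hx Hy.
- by rewrite /flip !lin_extZ -/flip !flipU rev_pathK.
Qed.

Lemma aug_flip v f : path_aug B v (flip f) = path_aug B v f.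
Proof.
elim/(@pelt_ind _ _ _ _ B): f => [|x y Hx Hy|c p].
- by rewrite /flip lin_ext0.
- by rewrite /flip lin_extD -/flip !rmorphD Hx Hy.
rewrite /flip lin_extZ -/flip [LHS]pcoefZ [RHS]pcoefZ flipU !pcoefU.
by rewrite -{1}(rev_path_triv Q v) (inj_eq (inv_inj (@rev_pathK _ _))).
Qed.

End PathReversal.

(** * The preprojective relation *)

Section Preproj.
Variables (K : fieldType) (n : nat) (Q : quiver 'I_n).
Local Notation R := (double_quiver Q).
Variables (KR : algebra K) (B : path_basis R KR).
Local Notation sc := (@alg_scalar K KR).
Local Notation arr b := (pelt B (arrow_path b)).
Local Notation vtx v := (pelt B (trivial_path R v)).
Local Notation aug := (path_aug B).
Local Notation eps b := ((-1) ^+ is_star b).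

Variable r : KR.
Hypothesis rE : r = \sum_(b : arrow R) eps b * (arr b * arr (star b)).
Local Notation "'L'" := (quotient_algebra (principal_ideal r)).
Local Notation pr := (quotient_map (principal_ideal r)).

Lemma aug_arr v b : aug v (arr b) = 0.
Proof. by rewrite path_augU (negPf (arrow_path_neq_triv _ _)). Qed.

Lemma aug_r v : aug v r = 0.
Proof.
rewrite rE rmorph_sum big1 // => b _.
by rewrite !rmorphM aug_arr mul0r mulr0.
Qed.

Lemma flip_r : flip B r = r.
Proof.
rewrite rE /flip lin_ext_sum -/(flip B); apply: eq_bigr => b _.
rewrite /flip lin_ext_sign -/(flip B) flipM !flipU !rev_path_arrow starK.
by [].
Qed.

Lemma vtxM u v : vtx u * vtx v = if u == v then vtx u else 0.
Proof. by rewrite peltM path_cat_trivl; case: eqP => [->|]. Qed.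

Lemma arr_vtx b v : arr b * vtx v = if tgt b == v then arr b else 0.
Proof.
rewrite peltM path_cat_trivr.
have -> : path_tgt (arrow_path b) = tgt b by [].
by case: eqP.
Qed.

Lemma vtx_arr b v : vtx v * arr b = if v == src b then arr b else 0.
Proof.
rewrite peltM path_cat_trivl.
have -> : path_src (arrow_path b) = src b by [].
by case: eqP.
Qed.

Lemma fox_arr b c : fox B b (arr c) = if c == b then vtx (src b) else 0.
Proof.
have e : path_cat (trivial_path R (src c)) (arrow_path c) = Some (arrow_path c).
  by rewrite path_cat_trivl eqxx.
rewrite /fox lin_extU; case: eqVneq => [<-|ne]; first exact: strip_path_cat.
exact: strip_path_neq e ne.
Qed.

(** The derivative removes [b] from the only term that ends with it. *)
Lemma fox_r b : fox B b r = eps (star b) * arr (star b).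
Proof.
have foxE c : fox B b (eps c * (arr c * arr (star c))) =
    eps c * (arr c * (if star c == b then vtx (src b) else 0)).
  rewrite [LHS]lin_ext_sign -/(fox B b) foxM fox_arr aug_arr rmorph0 mulr0.
  by rewrite addr0.
rewrite rE /fox lin_ext_sum -/(fox B b) (bigD1 (star b)) //= foxE starK eqxx.
rewrite arr_vtx tgt_star eqxx big1 ?addr0 // => c cb; rewrite foxE.
have -> : (star c == b) = false by apply/eqP => cE;
  rewrite -cE starK eqxx in cb.
by rewrite !mulr0.
Qed.

Lemma aug_ideal0 v z : z \in principal_ideal r -> aug v z = 0.
Proof.
case/asboolP => m [a [b ->]]; rewrite rmorph_sum big1 // => k _.
by rewrite !rmorphM aug_r mulr0 mul0r.
Qed.

(** Modulo the ideal, [fox b (x * r * y)] is [x * fox b r] times the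
    augmentation of [y] at the end of [b]; so the coefficient [a] is the same
    for all arrows with the same end, which is what exactness at [v]
    requires. *)
Lemma fox_ideal z v : z \in principal_ideal r -> exists a, forall b,
  tgt b = v ->
  fox B b z - a * (eps (star b) * arr (star b)) \in principal_ideal r.
Proof.
case/asboolP => m [x [y ->]].
exists (\sum_k x k * sc (aug v (y k))) => b bv;
  rewrite /fox lin_ext_sum -/(fox B b).
rewrite mulr_suml -sumrB rpred_sum // => k _.
rewrite -/(fox B b) foxM foxM bv aug_r rmorph0 mulr0 addr0 fox_r.
rewrite -[X in _ - X]mulrA [X in _ - x k * X]alg_central [X in _ - X]mulrA
  addrK.
apply/asboolP; exists 1%N, (fun=> x k), (fun=> fox B b (y k)).
by rewrite big_ord1.
Qed.

Lemma flip_ideal z : z \in principal_ideal r -> flip B z \in principal_ideal r.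
Proof.
case/asboolP => m [x [y ->]]; rewrite /flip lin_ext_sum -/(flip B).
apply/asboolP; exists m, (fun k => flip B (y k)), (fun k => flip B (x k)).
by apply: eq_bigr => k _; rewrite -/(flip B) !flipM flip_r mulrA.
Qed.

Definition lflip (x : L) : L := pr (flip B (repr x)).

Lemma lflipE f : lflip (pr f) = pr (flip B f).
Proof.
apply/eqP; rewrite quotient_map_eq -lin_extB; apply: flip_ideal.
by rewrite -quotient_map_eq quotient_reprK.
Qed.

Lemma pr_surj (x : L) : exists f, x = pr f.
Proof. by exists (repr x); rewrite quotient_reprK. Qed.

Lemma lflipM x y : lflip (x * y) = lflip y * lflip x.
Proof.
have [f ->] := pr_surj x; have [g ->] := pr_surj y.
by rewrite -rmorphM !lflipE flipM rmorphM.
Qed.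

Lemma lflipD x y : lflip (x + y) = lflip x + lflip y.
Proof.
have [f ->] := pr_surj x; have [g ->] := pr_surj y.
by rewrite -rmorphD !lflipE /flip lin_extD rmorphD.
Qed.

Lemma lflip0 : lflip 0 = 0.
Proof. by apply: (addrI (lflip 0)); rewrite -lflipD !addr0. Qed.

Lemma lflip_sum (T : finType)
  (F : T -> L) : lflip (\sum_t F t) = \sum_t lflip (F t).
Proof. exact: (big_morph lflip lflipD lflip0). Qed.

Lemma lflipK : involutive lflip.
Proof. by move=> x; have [f ->] := pr_surj x; rewrite !lflipE flipK. Qed.

Definition laug_fun v (x : L) : K := aug v (repr x).

Lemma laugE v f : laug_fun v (pr f) = aug v f.
Proof.
apply/eqP; rewrite -subr_eq0 -rmorphB; apply/eqP/aug_ideal0.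
by rewrite -quotient_map_eq quotient_reprK.
Qed.

Fact laug_zmod v : zmod_morphism (laug_fun v).
Proof.
move=> x y; have [f ->] := pr_surj x; have [g ->] := pr_surj y.
by rewrite -rmorphB !laugE rmorphB.
Qed.

Fact laug_monoid v : monoid_morphism (laug_fun v).
Proof.
split; first by rewrite -(rmorph1 pr) laugE rmorph1.
move=> x y; have [f ->] := pr_surj x; have [g ->] := pr_surj y.
by rewrite -rmorphM !laugE rmorphM.
Qed.

Definition laug v : {rmorphism L -> K} := HB.pack (laug_fun v)
  (GRing.isZmodMorphism.Build L K (laug_fun v) (laug_zmod v))
  (GRing.isMonoidMorphism.Build L K (laug_fun v) (laug_monoid v)).

End Preproj.

(** * Exactness at a vertex *)

Section PreprojVertex.
Variables (K : fieldType) (n : nat) (Q : quiver 'I_n).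
Local Notation R := (double_quiver Q).
Variables (KR : algebra K) (B : path_basis R KR).
Local Notation sc := (@alg_scalar K KR).
Local Notation arr b := (pelt B (arrow_path b)).
Local Notation vtx v := (pelt B (trivial_path R v)).
Local Notation aug := (path_aug B).
Local Notation eps b := ((-1) ^+ is_star b).

Variable r : KR.
Hypothesis rE : r = \sum_(b : arrow R) eps b * (arr b * arr (star b)).
Local Notation "'L'" := (quotient_algebra (principal_ideal r)).
Local Notation pr := (quotient_map (principal_ideal r)).
Local Notation rho b := (pr (arr b)).
Local Notation e v := (pr (vtx v)).
Local Notation laug := (laug rE).
Local Notation lflip := (@lflip _ _ _ _ B r).

Lemma laugpr v f : laug v (pr f) = aug v f.
Proof. exact: laugE. Qed.

Lemma left_expand (x : L) : exists y : arrow R -> L,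
  x = \sum_v @alg_scalar K L (laug v x) * e v + \sum_b y b * rho b.
Proof.
have [f ->] := pr_surj x; exists (fun b => pr (fox B b f)).
rewrite {1}(fox_expand B f) rmorphD !rmorph_sum; congr (_ + _).
  by apply: eq_bigr => v _; rewrite rmorphM laugpr.
by apply: eq_bigr => b _; rewrite rmorphM.
Qed.

Lemma left_rad (x : L) : (forall v, laug v x = 0) -> exists y : arrow R -> L,
  x = \sum_b y b * rho b.
Proof.
move=> x0; have [y xy] := left_expand x; exists y; rewrite {1}xy.
by rewrite big1 ?add0r // => v _; rewrite x0 rmorph0 mul0r.
Qed.

Hypothesis arr_nilp : exists N, forall s : seq (arrow R), size s = N ->
  \prod_(b <- s) rho b = 0.

(** A radical element is a sum of left multiples of arrows, so a product of
    radical elements can be rewritten from the right as a sum of products that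
    end with as many arrows. *)
Lemma rad_nilp : exists N, forall vs : seq L,
  size vs = N -> (forall x, x \in vs -> forall j, laug j x = 0) ->
  \prod_(x <- vs) x = 0.
Proof.
have [N nil] := arr_nilp; exists N.
have step vs : (forall x, x \in vs -> forall j, laug j x = 0) ->
    forall s y, (size vs + size s = N)%N ->
    (\prod_(x <- vs) x) * (y * \prod_(b <- s) rho b) = 0.
  elim/last_ind: vs => [|vs x IH] rv s y.
    by rewrite add0n => /nil ->; rewrite !mulr0.
  rewrite size_rcons addSnnS => sz.
  have rxy j : laug j (x * y) = 0.
    by rewrite rmorphM rv ?mul0r // mem_rcons mem_head.
  have [z xyz] := left_rad rxy.
  rewrite -cats1 big_cat big_seq1 -mulrA [x * _]mulrA xyz mulr_suml mulr_sumr.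
  apply: big1 => b _.
  have rvs u : u \in vs -> forall j, laug j u = 0.
    by move=> uvs; apply: rv; rewrite mem_rcons in_cons uvs orbT.
  by have := IH rvs (b :: s) (z b) sz; rewrite big_cons -mulrA.
move=> vs sz rv; have := step vs rv [::] 1.
by rewrite addn0 big_nil !mulr1; apply.
Qed.

Definition preproj_elementary : elementary L n.
Proof.
apply: (@Elementary K L n (fun v => e v) laug).
- by move=> u v; rewrite -rmorphM vtxM; case: eqP; rewrite ?rmorph0.
- by rewrite -rmorph_sum -(pelt1 B) rmorph1.
- move=> j c; rewrite [LHS]laugpr -[sc c]mulr1 [LHS]pcoefZ pcoef_triv1 mulr1 //.
- move=> j k; rewrite laugpr path_augU; congr ((nat_of_bool _)%:R).
  by apply/eqP/eqP => [/(congr1 (@path_src _ _))|->].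
- exact: rad_nilp.
Defined.

Variable i : 'I_n.
Hypothesis no_loop : forall b : arrow R, src b = tgt b -> tgt b <> i.
Variable b0 : arrow R.
Hypothesis b0i : tgt b0 = i.

Local Notation nbr := {b : arrow R | tgt b == i}.
Let inn (b : nbr) : L := rho (val b).
Let out (b : nbr) : L := (-1) ^+ is_star (star (val b)) * rho (star (val b)).

Lemma sum_nbr (F : arrow R -> L) :
  \sum_(b : nbr) F (val b) = \sum_(b | tgt b == i) F b.
Proof. by rewrite [RHS]big_sub. Qed.

Fact nbr_tgt (b : nbr) : tgt (val b) = i.
Proof. exact/eqP/(valP b). Qed.

Lemma rho_idem b v : rho b * e v = if tgt b == v then rho b else 0.
Proof. by rewrite -rmorphM arr_vtx; case: eqP; rewrite ?rmorph0. Qed.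

Lemma idem_rho b v : e v * rho b = if v == src b then rho b else 0.
Proof. by rewrite -rmorphM vtx_arr; case: eqP; rewrite ?rmorph0. Qed.

Lemma pr_relation :
  \sum_(b : arrow R) (-1) ^+ is_star b * (rho b * rho (star b)) = 0 :> L.
Proof.
transitivity (pr (\sum_(b : arrow R) eps b * (arr b * arr (star b)))).
  rewrite rmorph_sum; apply: eq_bigr => b _.
  by rewrite !rmorphM rmorphXn rmorphN1.
rewrite -rE; apply/eqP; rewrite quotient_map_eq0.
by apply/asboolP; exists 1%N, (fun=> 1), (fun=> 1);
  rewrite big_ord1 mul1r mulr1.
Qed.

Lemma relation_at : \sum_(b : nbr) out b * inn b = 0.
Proof.
rewrite (sum_nbr (fun b => (-1) ^+ is_star (star b) * rho (star b) * rho b)).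
rewrite -[RHS](mulr0 (e i)) -[in RHS]pr_relation mulr_sumr.
rewrite [RHS](reindex_inj (inv_inj (@starK _ _))) [LHS]big_mkcond.
apply: eq_bigr => b _; rewrite starK [RHS]mulrA commr_sign -[RHS]mulrA.
rewrite [e i * (_ * _)]mulrA idem_rho src_star [i == _]eq_sym.
by case: eqP; rewrite ?mul0r ?mulr0 // mulrA.
Qed.

Lemma inn_gen_at (x : L) : x * e i = x -> laug i x = 0 ->
  exists y : nbr -> L, x = \sum_b y b * inn b.
Proof.
move=> xe x0; have [y xy] := left_expand x; exists (fun b => y (val b)).
rewrite (sum_nbr (fun b => y b * rho b)) -{1}xe {1}xy mulrDl !mulr_suml.
rewrite big1 ?add0r => [|v _]; last first.
  rewrite -mulrA -rmorphM vtxM; case: eqP => [->|_];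
    last by rewrite rmorph0 mulr0.
  by rewrite x0 rmorph0 mul0r.
rewrite [RHS]big_mkcond; apply: eq_bigr => b _.
by rewrite -mulrA rho_idem; case: eqP; rewrite ?mulr0.
Qed.

(** A relation between the arrows lifts to an element of the ideal of relations
    of the path algebra, whose Fox derivatives are the coefficients. *)
Lemma inn_exact_at (x : nbr -> L) : (forall b, x b * e (src (val b)) = x b) ->
  \sum_b x b * inn b = 0 -> exists a, forall b, x b = a * out b.
Proof.
move=> xe x0; pose X b := repr (x b); pose Z := \sum_b X b * arr (val b).
have XE b : (pr : {rmorphism KR -> L}) (X b) = x b by apply: quotient_reprK.
have : Z \in principal_ideal r.
  rewrite -quotient_map_eq0 rmorph_sum; apply/eqP.
  apply: etrans x0; apply: eq_bigr => b _.
  by rewrite rmorphM; congr (_ * _); apply: XE.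
case/(fox_ideal rE i) => a Ha; exists (pr a) => c.
have := Ha (val c) (nbr_tgt c);
  rewrite -quotient_map_eq0 rmorphB subr_eq0 => /eqP.
rewrite !rmorphM rmorphXn rmorphN1 => <-.
rewrite /Z /fox lin_ext_sum -/(fox B (val c)) rmorph_sum (bigD1 c) //=.
rewrite -/(fox B (val c))
  foxM fox_arr aug_arr rmorph0 mulr0 addr0 eqxx rmorphM XE.
rewrite xe big1 ?addr0 // => b bc.
rewrite -/(fox B (val c)) foxM fox_arr aug_arr rmorph0 mulr0 addr0.
have -> : (val b == val c) = false by rewrite (inj_eq val_inj) (negPf bc).
by rewrite mulr0 rmorph0.
Qed.

Lemma lflip_idem v : lflip (e v) = e v.
Proof. by rewrite (lflipE rE) flipU rev_path_triv. Qed.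

Lemma lflip_rho b : lflip (rho b) = rho (star b).
Proof. by rewrite (lflipE rE) flipU rev_path_arrow. Qed.

Lemma lflip_sign (s : bool) x : lflip ((-1) ^+ s * x) = (-1) ^+ s * lflip x.
Proof.
case: s; rewrite ?mul1r // !mulN1r; apply: (addrI (lflip x)).
by rewrite -(lflipD rE) !subrr (lflip0 rE).
Qed.

Lemma lflip_inn b : lflip (inn b) = (-1) ^+ is_star (star (val b)) * out b.
Proof. by rewrite lflip_rho /out signrMK. Qed.

Lemma lflip_out b : lflip (out b) = (-1) ^+ is_star (star (val b)) * inn b.
Proof. by rewrite lflip_sign lflip_rho starK. Qed.

Lemma laug_lflip v x : laug v (lflip x) = laug v x.
Proof.
by have [f ->] := pr_surj x; rewrite (lflipE rE) !laugpr aug_flip.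
Qed.

(** This is [inn_gen_at] transported by the reversal of paths. *)
Lemma out_gen_at (x : L) : e i * x = x -> laug i x = 0 ->
  exists y : nbr -> L, x = \sum_b out b * y b.
Proof.
move=> ex x0; have [||y xy] := @inn_gen_at (lflip x).
- by rewrite -{2}ex (lflipM rE) lflip_idem.
- by rewrite laug_lflip.
exists (fun b => (-1) ^+ is_star (star (val b)) * lflip (y b)).
rewrite -[LHS](lflipK rE) xy (lflip_sum rE); apply: eq_bigr => b _.
by rewrite (lflipM rE) lflip_inn [RHS]mulrA commr_sign.
Qed.

Lemma out_exact_at (x : nbr -> L) : (forall b, e (src (val b)) * x b = x b) ->
  \sum_b out b * x b = 0 -> exists a, forall b, x b = inn b * a.
Proof.
move=> ex x0; pose y (b : nbr) := (-1) ^+ is_star (star (val b)) * lflip (x b).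
have [||a ya] := @inn_exact_at y.
- by move=> b; rewrite /y -mulrA -{2}ex (lflipM rE) lflip_idem.
- apply: etrans (etrans (congr1 lflip x0) (lflip0 rE)).
  rewrite (lflip_sum rE); apply: eq_bigr => b _.
  by rewrite (lflipM rE) lflip_out /y [RHS]mulrA commr_sign.
exists (lflip a) => b; have := ya b.
move/(congr1 ( *%R ((-1) ^+ is_star (star (val b))))); rewrite /y signrMK.
move/(congr1 lflip); rewrite (lflipK rE) => ->.
by rewrite lflip_sign (lflipM rE) lflip_out -mulrA signrMK.
Qed.

Lemma preproj_vertex_at : preproj_vertex preproj_elementary i.
Proof.
apply: (@PreprojVertex K L n preproj_elementary i nbr
  (exist _ b0 (introT eqP b0i)) (fun b => src (val b)) inn out).
- move=> b; apply/eqP => sb; apply: (@no_loop (val b)); last exact: nbr_tgt.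
  by rewrite sb nbr_tgt.
- by move=> b; rewrite [LHS]idem_rho eqxx.
- by move=> b; rewrite [LHS]rho_idem nbr_tgt eqxx.
- move=> b; rewrite -[idem _ i]/(e i) /out mulrA commr_sign -mulrA idem_rho.
  by rewrite src_star nbr_tgt eqxx.
- by move=> b; rewrite -mulrA [X in _ * X]rho_idem tgt_star eqxx.
- exact: relation_at.
- exact: inn_gen_at.
- exact: out_gen_at.
- exact: inn_exact_at.
- exact: out_exact_at.
Qed.

End PreprojVertex.

(** * Words in two nilpotent letters *)

Section Words.
Variables (L : pzRingType) (x y : L).

Definition letter (b : bool) : L := if b then x else y.
Definition word (w : seq bool) : L := \prod_(b <- w) letter b.

Lemma word_cat u v : word (u ++ v) = word u * word v.
Proof. exact: big_cat. Qed.

(** A list of signed words is evaluated as the sum of its terms; coefficients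
    other than one and minus one are obtained by repetition. *)
Definition poly_eval (p : seq (bool * seq bool)) : L :=
  \sum_(t <- p) (-1) ^+ t.1 * word t.2.

Lemma poly_eval_cat p q : poly_eval (p ++ q) = poly_eval p + poly_eval q.
Proof. exact: big_cat. Qed.

Lemma poly_eval_cons t p :
  poly_eval (t :: p) = (-1) ^+ t.1 * word t.2 + poly_eval p.
Proof. exact: big_cons. Qed.

Definition poly_sign (s : bool) (p : seq (bool * seq bool)) :=
  [seq (s (+) t.1, t.2) | t <- p].

Lemma poly_eval_sign s p : poly_eval (poly_sign s p) = (-1) ^+ s * poly_eval p.
Proof.
rewrite /poly_eval big_map mulr_sumr; apply: eq_bigr => t _ /=.
by rewrite signr_addb mulrA.
Qed.

Definition poly_shift u (p : seq (bool * seq bool)) v :=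
  [seq (t.1, u ++ t.2 ++ v) | t <- p].

Lemma poly_eval_shift u p v :
  poly_eval (poly_shift u p v) = word u * poly_eval p * word v.
Proof.
rewrite /poly_eval big_map mulr_sumr mulr_suml; apply: eq_bigr => t _ /=.
by rewrite !word_cat !mulrA (commr_sign (word u)).
Qed.

Definition rule_valid (rl : seq bool * seq (bool * seq bool)) :=
  word rl.1 = poly_eval rl.2.

End Words.

Definition rule := (seq bool * seq (bool * seq bool))%type.

Fixpoint rewrite_word (R : seq rule)
  (w : seq bool) : option (seq (bool * seq bool)) :=
  let head := [seq poly_shift [::] rl.2 (drop (size rl.1) w) |
    rl <- R & prefix rl.1 w] in
  if head is p :: _ then Some p
  else if w is b :: w' then omap (fun p => poly_shift [:: b] p [::])
    (rewrite_word R w')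
  else None.

Definition rewrite_term R (t : bool * seq bool) :=
  if rewrite_word R t.2 is Some p then poly_sign t.1 p else [:: t].

Definition insert_term (t : bool * seq bool) p :=
  if (~~ t.1, t.2) \in p then rem (~~ t.1, t.2) p else t :: p.

Fixpoint normalize (R : seq rule) (fuel : nat) p :=
  if fuel is m.+1 then
    normalize R m (foldr insert_term [::] (flatten (map (rewrite_term R) p)))
  else p.

Section Soundness.
Variables (L : pzRingType) (x y : L) (R : seq rule).
Hypothesis RV : forall rl, rl \in R -> rule_valid x y rl.
Local Notation word := (word x y).
Local Notation eval := (poly_eval x y).

Lemma rewrite_wordP w p : rewrite_word R w = Some p -> word w = eval p.
Proof.
have hP w' q : q \in [seq poly_shift [::] rl.2 (drop (size rl.1) w') |
  rl <- R & prefix rl.1 w'] ->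
    word w' = eval q.
  case/mapP=> rl; rewrite mem_filter => /andP[/prefixP[v wE] /RV rV] ->.
  by rewrite poly_eval_shift wE drop_size_cat // word_cat rV /word big_nil
    mul1r.
elim: w p => [|b w IH] p; rewrite [rewrite_word _ _]/=.
  by case hE: [seq _ | _ <- _ & _] => [//|q h] [<-]; apply: hP;
    rewrite hE mem_head.
case hE: [seq _ | _ <- _ & _] => [|q h]; last first.
  by case=> <-; apply: hP; rewrite hE mem_head.
case: (rewrite_word R w) IH => [q|//] IH [<-].
by rewrite poly_eval_shift -IH // -!word_cat cats0.
Qed.

Lemma rewrite_termP t : eval (rewrite_term R t) = (-1) ^+ t.1 * word t.2.
Proof.
rewrite /rewrite_term; case rE: (rewrite_word R t.2) => [p|].
  by rewrite poly_eval_sign -(rewrite_wordP rE).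
by rewrite poly_eval_cons /poly_eval big_nil addr0.
Qed.

Lemma insert_termP t p :
  eval (insert_term t p) = (-1) ^+ t.1 * word t.2 + eval p.
Proof.
rewrite /insert_term; case: ifP => [tp|_]; last exact: poly_eval_cons.
rewrite [in RHS]/poly_eval (perm_big _ (perm_to_rem tp)) big_cons /= addrA.
by rewrite signrN mulNr subrr add0r.
Qed.

Lemma normalizeP m p : eval (normalize R m p) = eval p.
Proof.
elim: m p => //= m IH p; rewrite IH;
  transitivity (eval (flatten (map (rewrite_term R) p))).
  by elim: flatten => //= t q IHq; rewrite insert_termP IHq poly_eval_cons.
elim: p {IH} => //= t p IHp; rewrite poly_eval_cat IHp rewrite_termP.
by rewrite poly_eval_cons.
Qed.

(** The word in which the left-hand sides of [A] and [B] overlap can be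
    rewritten by either rule.  The difference of the two results vanishes, and
    normalising it yields the new rule. *)
Lemma overlap_valid A B u v m rl : A \in R -> B \in R -> A.1 ++ v = u ++ B.1 ->
  normalize R m ((false, rl.1) :: poly_sign true rl.2 ++
    poly_shift [::] A.2 v ++ poly_sign true (poly_shift u B.2 [::])) = [::] ->
  rule_valid x y rl.
Proof.
move=> /RV VA /RV VB AB N0;
  have := normalizeP m ((false, rl.1) :: poly_sign true rl.2 ++
    poly_shift [::] A.2 v ++ poly_sign true (poly_shift u B.2 [::])).
rewrite {}N0 {1}/poly_eval big_nil poly_eval_cons !poly_eval_cat
  !poly_eval_sign.
rewrite !poly_eval_shift -VA -VB -!word_cat cats0 AB !mulN1r subrr addr0 mul1r.
by move/esym/eqP; rewrite subr_eq0 => /eqP.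
Qed.

(** Explores the extensions of [w] by [m] letters, stopping as soon as a prefix
    normalises to zero. *)
Fixpoint words_vanish (m fuel : nat) (w : seq bool) : bool :=
  (normalize R fuel [:: (false, w)] == [::]) ||
  (if m is k.+1 then words_vanish k fuel (rcons w true)
    && words_vanish k fuel (rcons w false)
   else false).

Lemma words_vanishP m fuel w : words_vanish m fuel w ->
  forall u, size u = m -> word (w ++ u) = 0.
Proof.
elim: m w => [|m IH] w /= /orP[/eqP N0|H] u su //.
- have := normalizeP fuel [:: (false, w)].
  rewrite N0 poly_eval_cons /poly_eval !big_nil addr0 mul1r word_cat => <-.
  by rewrite mul0r.
- have := normalizeP fuel [:: (false, w)].
  rewrite N0 poly_eval_cons /poly_eval !big_nil addr0 mul1r word_cat => <-.
  by rewrite mul0r.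
case/andP: H => Ht Hf; case: u su => [//|b u] [su]; rewrite -cat_rcons.
by case: b; apply: IH.
Qed.

End Soundness.

Fixpoint all_words (m : nat) : seq (seq bool) :=
  if m is k.+1 then map (cons true) (all_words k) ++ map (cons false)
    (all_words k)
  else [:: [::]].

Lemma exp_add_words (L : pzRingType) (x y : L) m :
  (x + y) ^+ m = poly_eval x y [seq (false, w) | w <- all_words m].
Proof.
elim: m => [|m IH]; first by rewrite poly_eval_cons /poly_eval /word !big_nil
  addr0 mul1r.
rewrite exprS IH /= map_cat poly_eval_cat mulrDl -!map_comp /poly_eval !big_map.
by rewrite !mulr_sumr; congr (_ + _); apply: eq_bigr => w _;
  rewrite /= !mul1r /word big_cons.
Qed.

(* A Groebner basis for the relations [x ^ 2 = y ^ 3 = (x + y) ^ 5 = 0] and the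
   degree lexicographic order with [x > y].  The rule of degree 5 is the
   expansion of [(x + y) ^ 5] modulo the first two, the others come from one
   overlap each. *)
Section Words235.
Local Notation x := true.
Local Notation y := false.

Definition rule_xx : rule := ([:: x; x], [::]).
Definition rule_yyy : rule := ([:: y; y; y], [::]).
Definition rule5 : rule := ([:: x; y; x; y; x],
  [:: (true, [:: x; y; x; y; y]); (true, [:: x; y; y; x; y]);
      (true, [:: y; x; y; x; y]); (true, [:: y; x; y; y; x]);
      (true, [:: y; y; x; y; x]); (true, [:: y; y; x; y; y])]).
Definition rule6 : rule := ([:: x; y; x; y; y; x],
  [:: (true, [:: x; y; y; x; y; x]); (false, [:: y; x; y; x; y; y]);
      (false, [:: y; x; y; y; x; y]); (false, [:: y; y; x; y; x; y])]).
Definition rule10 : rule := ([:: x; y; y; x; y; y; x; y; x; y],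
  [:: (true, [:: x; y; y; x; y; y; x; y; y; x]);
      (true, [:: y; x; y; y; x; y; y; x; y; x]);
      (true, [:: y; x; y; y; x; y; y; x; y; y]);
      (true, [:: y; y; x; y; y; x; y; y; x; y])]).
Definition rule12 : rule := ([:: x; y; y; x; y; y; x; y; y; x; y; y],
  [:: (false, [:: y; x; y; y; x; y; y; x; y; y; x; y]);
      (true, [:: y; y; x; y; y; x; y; y; x; y; y; x])]).

End Words235.

Lemma words_vanish235 (L : pzRingType) (a b : L) :
  a ^+ 2 = 0 -> b ^+ 3 = 0 -> (a + b) ^+ 5 = 0 ->
  forall w, size w = 15 -> word a b w = 0.
Proof.
move=> a2 b3 ab5.
have Vxx : rule_valid a b rule_xx.
  by rewrite /rule_valid /poly_eval /word !big_cons !big_nil /= mulr1.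
have Vyyy : rule_valid a b rule_yyy.
  by rewrite /rule_valid /poly_eval /word !big_cons !big_nil /= mulr1 -expr2
    -exprS.
have all_valid R rl : (forall rl',
  rl' \in R -> rule_valid a b rl') -> rule_valid a b rl ->
    forall rl', rl' \in rl :: R -> rule_valid a b rl'.
  by move=> VR V rl'; rewrite in_cons => /orP[/eqP->|/VR].
have V2 : forall rl, rl \in [:: rule_yyy; rule_xx] -> rule_valid a b rl.
  by apply: all_valid => // rl; rewrite inE => /eqP->.
have V5 : rule_valid a b rule5.
  have := normalizeP V2 9 ([seq (false, w) | w <- all_words 5] ++
    poly_sign true ((false, rule5.1) :: poly_sign true rule5.2)).
  have -> : normalize [:: rule_yyy;
    rule_xx] 9 ([seq (false, w) | w <- all_words 5] ++
    poly_sign true ((false, rule5.1) :: poly_sign true rule5.2)) = [::].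
    by vm_compute.
  rewrite {1}/poly_eval big_nil poly_eval_cat -exp_add_words ab5 add0r
    poly_eval_sign.
  rewrite poly_eval_cons poly_eval_sign mul1r !mulN1r => /esym/eqP.
  by rewrite oppr_eq0 subr_eq0 => /eqP.
have V3 := all_valid _ _ V2 V5.
have V6 : rule_valid a b rule6.
  by apply: (overlap_valid V3 (A := rule5) (B := rule_xx) (m := 20)
    (u := [:: true; false; true; false]) (v := [:: true])); vm_compute.
have V4 := all_valid _ _ V3 V6.
have V10 : rule_valid a b rule10.
  by apply: (overlap_valid V4 (A := rule5) (B := rule6) (m := 20)
    (u := [:: true; false; true; false]) (v := [:: false; true; false; false;
      true])); vm_compute.
have V7 := all_valid _ _ V4 V10.
have V12 : rule_valid a b rule12.
  by apply: (overlap_valid V7 (A := rule10) (B := rule_yyy) (m := 20)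
    (u := [:: true; false; false; true; false; false; true; false; true])
    (v := [:: false; false])); vm_compute.
have V8 := all_valid _ _ V7 V12.
by move=> w sw; apply: (words_vanishP V8 (m := 15) (fuel := 12)
  (w := [::])) => //; vm_compute.
Qed.

Lemma words_vanish1 (L : pzRingType) (a b : L) : a ^+ 2 = 0 -> a + b = 0 ->
  forall w, size w = 2 -> word a b w = 0.
Proof.
move=> a2 /(canRL (addKr a)); rewrite addr0 => bE.
have aa : a * a = 0 by rewrite -expr2.
case=> [|c [|d []]] // _; rewrite /word !big_cons big_nil mulr1 bE.
by case: c; case: d; rewrite /= ?mulrN ?mulNr aa ?oppr0.
Qed.

Section AlternatingWords.
Variables (L : pzRingType) (a b : L).
Hypotheses (a2 : a ^+ 2 = 0) (b2 : b ^+ 2 = 0).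
Local Notation letter := (letter a b).

Fixpoint alternating c m : L :=
  if m is k.+1 then letter c * alternating (~~ c) k else 1.

Lemma letter_sqr c : letter c * letter c = 0.
Proof. by rewrite -expr2; case: c. Qed.

Lemma letter_alternating c m : letter c * alternating c m.+1 = 0.
Proof. by rewrite /= mulrA letter_sqr mul0r. Qed.

(** A word with a repeated letter vanishes, since both letters square to
    zero. *)
Lemma word_alternating w : word a b w = 0 \/
  word a b w = alternating (head true w) (size w).
Proof.
elim: w => [|c w IH]; first by right; rewrite /word big_nil.
rewrite /word big_cons -/(word a b w) /=; case: IH => ->; first by left;
  rewrite mulr0.
case: w => [|d w] /=; first by right.
have [->|<-] : d = c \/ ~~ c = d by case: c d => [] []; auto.
  by left; rewrite mulrA letter_sqr mul0r.
by right.
Qed.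

Lemma exp_alternating m :
  (a + b) ^+ m.+1 = alternating true m.+1 + alternating false m.+1.
Proof.
elim: m => [|m IH]; first by rewrite /= !mulr1.
rewrite exprS IH mulrDl !mulrDr.
by rewrite [a * alternating true _](letter_alternating true)
  [b * alternating false _](letter_alternating false) addr0 add0r.
Qed.

(** Multiplying [(a + b) ^ m] by one letter leaves a single alternating word. *)
Lemma words_vanish22 m : (a + b) ^+ m = 0 -> forall w,
  size w = m.+1 -> word a b w = 0.
Proof.
case: m => [|m] ab0 w sw.
  have triv : (1 : L) = 0 by rewrite -ab0.
  by rewrite -[LHS]mulr1 triv mulr0.
have [//|->] := word_alternating w; rewrite sw; set c := head true w.
have : letter c * (a + b) ^+ m.+1 = alternating c m.+2.
  rewrite exp_alternating mulrDr; case: c.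
    by rewrite letter_alternating add0r.
  by rewrite addrC letter_alternating add0r.
by rewrite ab0 mulr0.
Qed.

End AlternatingWords.

Section LinearCombinations.
Variables (L : pzRingType) (a b : L) (m : nat).
Hypothesis wab : forall w, size w = m -> word a b w = 0.

(** Substituting sums of letters for letters only leads to sums of words of the
    same length. *)
Lemma words_vanish_span (T : Type) (z : T -> L) :
  (forall t, z t = a \/ z t = b \/ z t = - (a + b)) ->
  forall s, (m <= size s)%N -> \prod_(t <- s) z t = 0.
Proof.
move=> zP.
have step s : forall w,
  (m <= size w + size s)%N -> word a b w * \prod_(t <- s) z t = 0.
  elim: s => [|t s IH] w /= le_m.
    rewrite big_nil mulr1 -(cat_take_drop m w) word_cat wab ?mul0r //.
    by rewrite size_takel // -[size w]addn0.
  have H c : word a b w * (letter a b c * \prod_(t <- s) z t) = 0.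
    have := IH (rcons w c); rewrite -cats1 word_cat size_cat addn1 addSnnS.
    by rewrite /word big_seq1 -mulrA => ->.
  rewrite big_cons; case: (zP t) => [->|[->|->]];
    [exact: H true|exact: H false|].
  by rewrite mulNr mulrDl mulrN mulrDr (H true) (H false) addr0 oppr0.
by move=> s sm; have := step s [::]; rewrite /word big_nil mul1r; apply.
Qed.

End LinearCombinations.

(** * Walks in a star *)

(** A star with centre [c] and three arms: [O a k] goes from depth [k] to depth
    [k.+1] in the arm [a], and [I a k] goes back.  The relation at a vertex of
    positive depth says that the step inwards and back equals the step outwards
    and back; at the end of an arm the latter is zero. *)
Section Star.
Variables (L : pzRingType) (O I : 'I_3 -> nat -> L) (c : L) (len : 'I_3 -> nat).
Hypothesis O_long : forall a k, (len a <= k)%N -> O a k = 0.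
Hypothesis I_long : forall a k, (len a <= k)%N -> I a k = 0.
Hypothesis cO : forall a, c * O a 0 = O a 0.
Hypothesis Ic : forall a, I a 0 * c = I a 0.
Hypothesis arm_rel : forall a k, I a k * O a k = O a k.+1 * I a k.+1.

Definition loop a := O a 0 * I a 0.

Fixpoint outward a k : L := if k is m.+1 then outward a m * O a m else 1.
Fixpoint inward a l k : L := if k is m.+1 then inward a l.+1 m * I a l else 1.

(** A step back on a direct path from the centre equals a loop at the centre,
    because the relations move the turning point down the arm. *)
Lemma outward_loop a k : outward a k.+1 * I a k = loop a * outward a k.
Proof.
elim: k => [|k IH]; first by rewrite /= mul1r mulr1.
by rewrite -[LHS]mulrA -arm_rel mulrA IH mulrA.
Qed.

Lemma inwardSl a l k : inward a l k.+1 = I a (l + k) * inward a l k.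
Proof.
elim: k l => [|k IH] l; first by rewrite /= mul1r mulr1 addn0.
by rewrite -[LHS]/(inward a l.+1 k.+1 * I a l) IH addSnnS -mulrA.
Qed.

Lemma inward_O a l k : inward a l k * O a l = O a (l + k) * inward a l.+1 k.
Proof.
elim: k l => [|k IH] l /=; first by rewrite mul1r mulr1 addn0.
by rewrite -mulrA arm_rel mulrA IH -mulrA addSnnS.
Qed.

Lemma outward_long a k : (len a < k)%N -> outward a k = 0.
Proof. by case: k => // k lk; rewrite /= O_long ?mulr0. Qed.

Lemma loop_exp a k : loop a ^+ k = outward a k * inward a 0 k.
Proof.
elim: k => [|k IH]; first by rewrite /= mul1r.
rewrite exprS IH mulrA -outward_loop -mulrA inwardSl add0n.
by rewrite -mulrA.
Qed.

Lemma loop_nilp a : loop a ^+ (len a).+1 = 0.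
Proof. by rewrite loop_exp outward_long ?mul0r. Qed.

(** The three points of depth zero are the same vertex. *)
Definition node (a : 'I_3) k : option ('I_3 * nat) :=
  if k is 0%N then None else Some (a, k).

Definition move := (bool * 'I_3 * nat)%type.
Definition move_elt (m : move) : L :=
  let: (out, a, k) := m in if out then O a k else I a k.
Definition move_src (m : move) := let: (out, a,
  k) := m in if out then node a k else node a k.+1.
Definition move_tgt (m : move) := let: (out, a,
  k) := m in if out then node a k.+1 else node a k.

Fixpoint move_walk v (s : seq move) : bool :=
  if s is m :: s' then (move_src m == v) && move_walk (move_tgt m) s' else true.

Variable W : nat.
Hypothesis loops_vanish : forall s : seq 'I_3,
  (W <= size s)%N -> \prod_(a <- s) loop a = 0.
Variable M : nat.
Hypothesis lenM : forall a, (len a <= M)%N.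

Lemma loop_c a : loop a * c = loop a.
Proof. by rewrite -mulrA Ic. Qed.
Lemma c_loop a : c * loop a = loop a.
Proof. by rewrite mulrA cO. Qed.

(** The state of a walk from the centre is a word [w] in the loops followed by a
    direct path to depth [k].  A step outwards increases [k]; by [outward_loop]
    a step inwards decreases [k] and adds a letter to [w].  In both cases [2 *
    size w + k] grows by one. *)
Lemma walk_from_center s w a k : move_walk (node a k) s ->
  (2 * W + M < 2 * size w + k + size s)%N ->
  \prod_(b <- w) loop b * (c * (outward a k * \prod_(m <- s) move_elt m)) = 0.
Proof.
elim: s w a k => [|[[o b] l] s IH] w a k.
  move=> _; rewrite addn0 => le_WM.
  have [leW|ltW] := leqP W (size w); first by rewrite loops_vanish ?mul0r.
  by rewrite outward_long ?mul0r ?mulr0 //; have := lenM a; lia.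
rewrite [move_walk _ _]/= big_cons => /andP[src_m walk_s].
rewrite [size (_ :: _)]/= => le_WM.
case: o src_m walk_s => [|] /= src_m walk_s.
  have -> : outward a k * (O b l * \prod_(m <- s) move_elt m) =
      outward b k.+1 * \prod_(m <- s) move_elt m.
    by case: k l src_m {walk_s le_WM} => [|k] [|l] //= /eqP; [|case=> -> ->];
      rewrite ?mul1r ?mulrA.
  have kl : l = k by case: k l src_m {walk_s le_WM} => [|k] [|l] //= /eqP[_ ->].
  by apply: (IH w b k.+1); [rewrite -kl|lia].
case: k src_m le_WM walk_s => [//|k] /= /eqP[-> ->] le_WM walk_s.
have -> : c * (outward a k.+1 * (I a k * \prod_(m <- s) move_elt m)) =
    loop a * (c * (outward a k * \prod_(m <- s) move_elt m)).
  rewrite [outward _ _ * _]mulrA outward_loop -[loop a * _ * _]mulrA.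
  by rewrite [LHS]mulrA c_loop [RHS]mulrA loop_c.
have := IH (rcons w a) a k walk_s;
  rewrite size_rcons -cats1 big_cat big_seq1 -mulrA.
by apply; lia.
Qed.

Lemma walk_center s : move_walk None s -> (2 * W + M < size s)%N ->
  \prod_(m <- s) move_elt m = 0.
Proof.
move=> walk_s le_s; have := walk_from_center (w := [::]) (a := ord0)
  (k := 0) walk_s.
rewrite big_nil !mul1r => <- //.
case: s walk_s le_s => [//|[[o b] l] s] /= /andP[/eqP src_m _] _.
rewrite big_cons mulrA; congr (_ * _).
by case: o src_m => //=; case: l => //= _; rewrite cO.
Qed.

(** The state of a walk in an arm that has not met the centre is a path [y] to
    depth [l + k] followed by [k] steps inwards.  A step inwards adds to these;
    by [inward_O] a step outwards can be moved to their left, which extends [y].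
    In both cases [2 * (l + k) - l] grows by one, whereas [y] is zero beyond the
    end of the arm; so the walk vanishes or reaches the centre with many steps
    left. *)
Lemma walk_from_arm s a l k y : move_walk (node a l) s ->
  ((len a < l + k)%N -> y = 0) ->
  (l + (3 * M + 2 * W + 1) <= size s + 2 * (l + k))%N ->
  y * (inward a l k * \prod_(m <- s) move_elt m) = 0.
Proof.
elim: s l k y => [|[[o b] j] s IH] l k y.
  move=> _ y0 le_s; rewrite y0 ?mul0r //; have := lenM a.
  by move: le_s; rewrite [size _]/=; lia.
rewrite [size (_ :: _)]/=; case: l => [|l] walk_s y0 le_s.
  have [ltM|leM] := ltnP M k; first by rewrite y0 ?mul0r //; have := lenM a;
    lia.
  by rewrite (walk_center walk_s) ?mulr0 //=; lia.
move: walk_s; rewrite [move_walk _ _]/= big_cons => /andP[src_m walk_s].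
case: o src_m walk_s => [|] /=.
  case: j => // j /eqP[-> ->] walk_s.
  rewrite [inward a l.+1 k * _]mulrA inward_O -mulrA mulrA.
  apply: IH => //; last by move: le_s; lia.
  by move=> lt; rewrite O_long ?mulr0 //; move: lt; lia.
move=> /eqP[-> ->] walk_s; rewrite [inward a l.+1 k * _]mulrA.
rewrite -[inward a l.+1 k * I a l]/(inward a l k.+1).
apply: IH => //; first by rewrite addnS -addSn.
by move: le_s; lia.
Qed.

Lemma star_walks_vanish s v : move_walk v s -> (3 * M + 2 * W + 1 < size s)%N ->
  \prod_(m <- s) move_elt m = 0.
Proof.
case: s => [//|[[o a] k] s] /andP[_];
  rewrite big_cons [size _]/= => walk_s le_s.
case: o walk_s => walk_s.
  have := @walk_from_arm s a k.+1 0 (O a k) walk_s;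
    rewrite [inward _ _ _]/= mul1r.
  by apply=> [lt|]; [rewrite O_long //; lia|lia].
have := @walk_from_arm s a k 0 (I a k) walk_s; rewrite [inward _ _ _]/= mul1r.
by apply=> [lt|]; [rewrite I_long //; lia|lia].
Qed.

End Star.

(** * Dynkin diagrams as stars *)

Section DynkinStar.
Local Open Scope nat_scope.

(** The diagrams of types A, D and E with at least two vertices: a chain [0,
    ..., n - 2] and the vertex [n - 1] attached to the vertex [b] of the chain.
    In type A it is attached to the end of the chain. *)
Definition star_edge (b n u v : nat) : bool :=
  (v == u.+1) && (v < n.-1) || (u == b) && (v == n.-1).

Definition star_adj b n u v := star_edge b n u v || star_edge b n v u.

(** The last clause bounds the part of the chain beyond [b], separately for the
    types A, D and E. *)
Lemma dynkin_star t n : dynkin_size t n -> 1 < n -> exists b,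
  [/\ b < n.-1,
      forall u v, u < n -> v < n -> dynkin_adj t n u v = star_adj b n u v
    & [\/ n.-2 - b = 0, n.-2 - b = 1 | b = 2 /\ n.-2 - b <= 4]].
Proof.
case: t => /= size_n n1.
(* [b] is the branch vertex; type A has the arm above [b] empty. *)
- exists (n - 2); split; first lia.
    move=> u v un vn; rewrite /dynkin_adj /star_adj /dynkin_edge /star_edge.
    by congr (_ || _); lia.
  by constructor 1; lia.
- exists (n - 3); split; [lia| |by constructor 2; lia].
  by move=> u v _ _; rewrite /dynkin_adj /star_adj /dynkin_edge /star_edge.
- exists 2; split; [lia| |by constructor 3; lia].
  by move=> u v _ _; rewrite /dynkin_adj /star_adj /dynkin_edge /star_edge.
Qed.

Definition arm_len (b n : nat) (a : 'I_3) : nat :=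
  if a == 0 :> nat then 1 else if a == 1 :> nat then b else n.-2 - b.

Definition arm (k : nat) (k3 : k < 3) : 'I_3 := Ordinal k3.

(** The arm and the depth of a vertex, with centre [b]: arm 0 is the vertex
    [n - 1], arm 1 the chain below [b] and arm 2 the chain above [b]. *)
Definition arm_coord (b n u : nat) : 'I_3 * nat :=
  if u == n.-1 then (@arm 0 isT, 1) else
  if u <= b then (@arm 1 isT, b - u) else (@arm 2 isT, u - b).

Definition coord_node (p : 'I_3 * nat) := node p.1 p.2.

Variables (b n : nat).
Hypothesis bn : b < n.-1.
Local Notation coord := (arm_coord b n).

Lemma coord_len u : u < n -> (coord u).2 <= arm_len b n (coord u).1.
Proof.
rewrite /arm_coord /arm_len => un; case: eqP => //= un1.
by case: (leqP u b) => /= ub; lia.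
Qed.

Lemma arm_coord_inj u v : u < n -> v < n ->
  coord_node (coord u) = coord_node (coord v) -> u = v.
Proof.
move=> un vn; rewrite /arm_coord.
have nodeI a k a' k' : node a k = node a' k' ->
  (k = 0 /\ k' = 0) \/ (a = a' /\ k = k').
  by case: k k' => [|k] [|k'] //=; [left|case=> -> ->; right].
case: eqP => [->|u1]; case: eqP => [->|v1] //; rewrite ?(fun_if coord_node).
- case: (leqP v b) => vb /nodeI /= [[]|[]] //; lia.
- case: (leqP u b) => ub /nodeI /= [[]|[]] //; lia.
by case: (leqP u b) => ub; case: (leqP v b) => vb /nodeI /= [[]|[]] //; lia.
Qed.

Lemma coord_center u : u < n -> ((coord u).2 == 0) = (u == b).
Proof.
move=> un; rewrite /arm_coord; case: (u =P n.-1) => [->|u1] /=; first lia.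
by case: (leqP u b) => /= ub; lia.
Qed.

Lemma adj_coord u v : u < n -> v < n -> star_adj b n u v ->
  (coord u).2 < (coord v).2 ->
  coord_node (coord u) = node (coord v).1 (coord u).2 /\ (coord v).2 =
    (coord u).2.+1.
Proof.
move=> un vn; rewrite /star_adj /star_edge /arm_coord /coord_node.
case: (u =P n.-1) => [->|u1]; case: (v =P n.-1) => [->|v1] /=.
- lia.
- by case: (leqP v b) => vb /=; lia.
- case: (leqP u b) => ub /=; last lia.
  by move=> uv; have -> : b - u = 0 by lia.
case: (leqP u b) => ub; case: (leqP v b) => vb /=.
- by move=> *; split=> //; lia.
- move=> uv lt; have ub0 : b - u = 0 by lia.
  by rewrite ub0; split=> //; lia.
- by lia.
- by move=> *; split=> //; lia.
Qed.

Lemma adj_depth u v : u < n -> v < n -> star_adj b n u v ->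
  (coord u).2 <> (coord v).2.
Proof.
move=> un vn; rewrite /star_adj /star_edge /arm_coord.
case: (u =P n.-1) => [->|u1]; case: (v =P n.-1) => [->|v1] /=; first lia.
- by case: (leqP v b) => vb /=; lia.
- by case: (leqP u b) => ub /=; lia.
by case: (leqP u b) => ub; case: (leqP v b) => vb /=; lia.
Qed.

Lemma star_adj_irr u : star_adj b n u u = false.
Proof. by rewrite /star_adj /star_edge; lia. Qed.

Lemma star_adj_ex u : u < n -> exists2 v, v < n & star_adj b n u v.
Proof.
move=> un; case: (u =P n.-1) => [->|u1].
  by exists b; rewrite /star_adj /star_edge; lia.
case: (ltngtP u b) => [ub|ub|->].
- by exists u.+1; rewrite /star_adj /star_edge; lia.
- by exists u.-1; rewrite /star_adj /star_edge; lia.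
- by exists n.-1; rewrite /star_adj /star_edge; lia.
Qed.

End DynkinStar.

Section StarQuiver.
Variables (n : nat) (Q : quiver 'I_n) (s : 'I_n -> 'I_n) (b : nat).
Hypotheses (s_bij : bijective s) (bn : (b < n.-1)%N).
Hypothesis adjE : forall i j, num_edges Q i j = star_adj b n (s i) (s j).
Local Notation R := (double_quiver Q).

Lemma edge_adj (a : arrow Q) i j : ((src a == i) && (tgt a == j)) ||
  ((src a == j) && (tgt a == i)) -> star_adj b n (s i) (s j).
Proof.
move=> H; have : (0 < num_edges Q i j)%N.
  by rewrite card_gt0; apply/set0Pn; exists a; rewrite inE.
by rewrite adjE; case: star_adj.
Qed.

Lemma arrow_adj (c : arrow R) : star_adj b n (s (src c)) (s (tgt c)).
Proof. by case: c => a; apply: (@edge_adj a); rewrite !eqxx ?orbT. Qed.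

Lemma arrow_loopless (c : arrow R) : src c <> tgt c.
Proof. by move=> e; have := arrow_adj c; rewrite e star_adj_irr. Qed.

Lemma edge_uniq (a a' : arrow Q) i j :
  ((src a == i) && (tgt a == j)) || ((src a == j) && (tgt a == i)) ->
  ((src a' == i) && (tgt a' == j)) || ((src a' == j) && (tgt a' == i)) ->
    a = a'.
Proof.
move=> H H'; have : (num_edges Q i j <= 1)%N by rewrite adjE; case: star_adj.
by move/card_le1_eqP; apply; rewrite inE.
Qed.

Lemma arrow_uniq (c c' : arrow R) : src c = src c' -> tgt c = tgt c' -> c = c'.
Proof.
case: c c' => [a|a] [a'|a'] /= es et.
- by congr inl; apply: (@edge_uniq a a' (src a) (tgt a)); rewrite ?es ?et !eqxx.
- have aa : a = a' by apply: (@edge_uniq a a' (src a) (tgt a));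
  rewrite ?es ?et !eqxx ?orbT.
  by have := @arrow_loopless (inl a); rewrite /= es aa.
- have aa : a = a' by apply: (@edge_uniq a a' (src a) (tgt a));
  rewrite ?es ?et !eqxx ?orbT.
  by have := @arrow_loopless (inl a); rewrite /= et -aa.
- by congr inr; apply: (@edge_uniq a a' (src a) (tgt a));
  rewrite ?es ?et !eqxx ?orbT.
Qed.

Lemma arrow_into i : exists c : arrow R, tgt c = i.
Proof.
have [v vn iv] := star_adj_ex bn (ltn_ord (s i)).
have [t st ts] := s_bij; pose j := t (Ordinal vn).
have : (0 < num_edges Q i j)%N by rewrite adjE ts iv.
rewrite card_gt0 => /set0Pn[a];
  rewrite inE => /orP[/andP[/eqP ai _]|/andP[_ /eqP ai]].
  by exists (inr a).
by exists (inl a).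
Qed.

Local Notation coord v := (arm_coord b n (s v)).
Local Notation depth v := (coord v).2.
Local Notation pt v := (coord_node (coord v)).

Definition is_out (c : arrow R) : bool := (depth (src c) < depth (tgt c))%N.

Definition move_of (c : arrow R) : move :=
  if is_out c then (true, (coord (tgt c)).1, depth (src c))
  else (false, (coord (src c)).1, depth (tgt c)).

Lemma is_out_star c : is_out (star c) = ~~ is_out c.
Proof.
rewrite /is_out src_star tgt_star.
have := adj_depth bn (ltn_ord _) (ltn_ord _) (arrow_adj c).
by move=> ne; apply/idP/idP; lia.
Qed.

Lemma move_star c : move_of (star c) =
  (~~ (move_of c).1.1, (move_of c).1.2, (move_of c).2).
Proof.
rewrite /move_of is_out_star src_star tgt_star.
by case: (is_out c).
Qed.

Lemma move_srcE c : move_src (move_of c) = pt (src c).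
Proof.
rewrite /move_of; case: ifP => /= oc.
  have [e _] := adj_coord bn (ltn_ord _) (ltn_ord _) (arrow_adj c) oc.
  exact: esym e.
have oc' : is_out (star c) by rewrite is_out_star oc.
have := arrow_adj (star c); rewrite src_star tgt_star => ac.
move: oc'; rewrite /is_out src_star tgt_star => oc'.
have [_ e] := adj_coord bn (ltn_ord _) (ltn_ord _) ac oc'.
by rewrite /coord_node e.
Qed.

Lemma move_tgtE c : move_tgt (move_of c) = pt (tgt c).
Proof.
have := move_srcE (star c); rewrite src_star => <-; rewrite move_star.
by case: (move_of c) => [[[] a] k].
Qed.

Lemma pt_inj : injective (fun v => pt v).
Proof.
move=> u v /(arm_coord_inj bn (ltn_ord _) (ltn_ord _)) /val_inj.
exact: (bij_inj s_bij).
Qed.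

Lemma move_inj : injective move_of.
Proof.
move=> c c' e; apply: arrow_uniq; apply: pt_inj.
  by rewrite /= -!move_srcE e.
by rewrite /= -!move_tgtE e.
Qed.

Lemma move_len c : ((move_of c).2 < arm_len b n (move_of c).1.2)%N.
Proof.
wlog oc : c / is_out c.
  move=> H; case oc: (is_out c); first exact: H.
  by have := H (star c); rewrite is_out_star oc move_star; apply.
rewrite /move_of oc /=; have := coord_len bn (ltn_ord (s (tgt c))).
have [_ ->] := adj_coord bn (ltn_ord _) (ltn_ord _) (arrow_adj c) oc.
by [].
Qed.

End StarQuiver.

(** * Nilpotency for Dynkin quivers *)

Section StarNilpotent.
Variables (n : nat) (Q : quiver 'I_n) (s : 'I_n -> 'I_n) (b : nat).
Hypotheses (s_bij : bijective s) (bn : (b < n.-1)%N).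
Hypothesis adjE : forall i j, num_edges Q i j = star_adj b n (s i) (s j).
Local Notation R := (double_quiver Q).
Variables (L : pzRingType) (e : 'I_n -> L) (rho : arrow R -> L).
Hypothesis rho_idem : forall c v, rho c * e v = if tgt c == v then rho c else 0.
Hypothesis idem_rho : forall c v, e v * rho c = if v == src c then rho c else 0.
Hypothesis relation_src : forall v,
  \sum_(c | src c == v) (-1) ^+ is_star c * (rho c * rho (star c)) = 0.

Local Notation coord v := (arm_coord b n (s v)).
Local Notation pt v := (coord_node (coord v)).
Local Notation outw := (@is_out n Q s b).
Local Notation mv := (@move_of n Q s b).
Local Notation len := (arm_len b n).

(** The signs of the preprojective relation depend on the orientation of the
    quiver.  Replacing [a], [star a] by [star a], [- a] preserves the relation,
    so one may assume that all arrows of the quiver point away from the centre: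
    [out_sign] marks the arrows that receive a minus sign. *)
Definition out_sign (c : arrow R) := ~~ is_star c && ~~ outw c.

Definition signed c : L := (-1) ^+ out_sign c * rho c.

Definition arm_elt (m : move) : L := \sum_(c | mv c == m) signed c.

Let O a k := arm_elt (true, a, k).
Let I a k := arm_elt (false, a, k).

Lemma arm_eltE c : arm_elt (mv c) = signed c.
Proof.
apply: big_pred1 => d; apply/eqP/eqP => [|->//].
exact: (move_inj s_bij bn adjE).
Qed.

(** Each sum has at most one term, as there is at most one arrow between two
    vertices. *)
Lemma arm_eltM m : arm_elt m * arm_elt (~~ m.1.1, m.1.2, m.2) =
  \sum_(c | mv c == m) signed c * signed (star c).
Proof.
case: (pickP (fun c => mv c == m)) => [c /eqP mc|none]; last first.
  by rewrite {1}/arm_elt !big_pred0 // mul0r.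
rewrite -mc -(move_star bn adjE) !arm_eltE (big_pred1 c) // => d.
apply/eqP/eqP => [|->//]; exact: (move_inj s_bij bn adjE).
Qed.

Lemma signed_star c : signed c * signed (star c) =
  if outw c then (-1) ^+ is_star c * (rho c * rho (star c))
  else - ((-1) ^+ is_star c * (rho c * rho (star c))).
Proof.
rewrite /signed /out_sign (is_out_star bn adjE) is_starN.
case: (outw c); case: (is_star c);
  by rewrite /= ?expr1 ?expr0 ?mul1r ?mulN1r ?mulrN ?mulNr ?opprK.
Qed.

Lemma relation_signed v : \sum_(c |
  (src c == v) && outw c) signed c * signed (star c) =
  \sum_(c | (src c == v) && ~~ outw c) signed c * signed (star c).
Proof.
apply/eqP; rewrite -subr_eq0 -sumrN -[X in _ == X](relation_src v).
rewrite [X in _ == X](bigID outw) /=; apply/eqP; congr (_ + _).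
  by apply: eq_bigr => c /andP[_ oc]; rewrite signed_star oc.
by apply: eq_bigr => c /andP[_ /negPf oc]; rewrite signed_star oc opprK.
Qed.

Lemma arm_elt_long m : (len m.1.2 <= m.2)%N -> arm_elt m = 0.
Proof.
move=> le_m; apply: big_pred0 => c; apply/eqP => mc.
by have := move_len bn adjE c; rewrite mc ltnNge le_m.
Qed.

(** This is the relation at the vertex of depth [k.+1] in the arm [a]; if there
    is no such vertex, both sides are empty sums. *)
Lemma arm_relation a k : I a k * O a k = O a k.+1 * I a k.+1.
Proof.
rewrite (arm_eltM (false, a, k)) (arm_eltM (true, a, k.+1)).
case: (pickP (fun v => pt v == node a k.+1)) => [v /eqP ptv|none]; last first.
  rewrite !big_pred0 // => c; apply/eqP => mc.
    by have := none (src c); rewrite -(move_srcE bn adjE) mc eqxx.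
  by have := none (src c); rewrite -(move_srcE bn adjE) mc eqxx.
have srcP c : (src c == v) = (move_src (mv c) == node a k.+1).
  rewrite (move_srcE bn adjE) -ptv; apply/eqP/eqP => [->//|].
  exact: (pt_inj s_bij bn).
have outP c : outw c = (mv c).1.1 by rewrite /move_of; case: (outw c).
have rel := relation_signed v.
transitivity (\sum_(c | (src c == v) && ~~ outw c) signed c * signed (star c)).
  apply: eq_bigl => c; rewrite srcP outP; case: (mv c) => [[[] a'] k'] //=.
    by rewrite andbF.
  by rewrite andbT.
rewrite -rel; apply: eq_bigl => c; rewrite srcP outP.
case: (mv c) => [[[] a'] k'] //=; last by rewrite andbF.
rewrite andbT; apply/eqP/eqP => [|[-> ->] //]; by case: k' => [|k'] // [-> ->].
Qed.

Lemma center_ex : exists v, s v = b :> nat.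
Proof.
have lt : (b < n)%N by move: bn; lia.
have [t st ts] := s_bij; exists (t (Ordinal lt)); by rewrite ts.
Qed.

Lemma pt_center v : s v = b :> nat -> pt v = None.
Proof.
move=> sv; have := coord_center bn (ltn_ord (s v)); rewrite sv eqxx.
by rewrite /coord_node; case: (arm_coord _ _ _) => a [|k].
Qed.

Lemma src_center v c : s v = b :> nat ->
  (src c == v) = (outw c && ((mv c).2 == 0)%N).
Proof.
move=> /pt_center ptv; apply/eqP/idP => [sc|].
  have := move_srcE bn adjE c; rewrite sc ptv /move_of.
  by case: (outw c) => //=; case: (_.2).
rewrite /move_of; case oc: (outw c) => //= /eqP k0; apply: (pt_inj s_bij bn).
by rewrite /= ptv -(move_srcE bn adjE) /move_of oc /= k0.
Qed.

Lemma center_relation : \sum_a O a 0 * I a 0 = 0.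
Proof.
have [v sv] := center_ex.
have rel0 : \sum_(c | (src c == v) && outw c) signed c * signed (star c) = 0.
  rewrite relation_signed big_pred0 // => c.
  by rewrite (src_center c sv); case: (outw c); rewrite ?andbF.
apply: etrans rel0; rewrite [RHS](partition_big (fun c => (mv c).1.2) xpredT)
  //=.
apply: eq_bigr => a _; rewrite (arm_eltM (true, a, 0%N)); apply: eq_bigl => c.
rewrite (src_center c sv) /move_of; case: (outw c) => //=.
by rewrite andbT xpair_eqE /= xpair_eqE /= andbC.
Qed.

Lemma arm_out_center v a : s v = b :> nat -> e v * O a 0 = O a 0.
Proof.
move=> sv; rewrite mulr_sumr; apply: eq_bigr => c /eqP mc.
rewrite /signed mulrA commr_sign -mulrA idem_rho eq_sym (src_center c sv)
  mc eqxx andbT.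
have -> : outw c; last by [].
by move: mc; rewrite /move_of; case: (outw c).
Qed.

Lemma arm_in_center v a : s v = b :> nat -> I a 0 * e v = I a 0.
Proof.
move=> sv; rewrite mulr_suml; apply: eq_bigr => c /eqP mc.
rewrite /signed -mulrA rho_idem -(src_star c) (src_center _ sv)
  (move_star bn adjE) mc eqxx andbT.
rewrite (is_out_star bn adjE); have -> : outw c = false; last by [].
by move: mc; rewrite /move_of; case: (outw c).
Qed.

Lemma loop_exp0 a : loop O I a ^+ (len a).+1 = 0.
Proof.
apply: (loop_nilp (len := len)) => [a' k|a' k];
  first exact: (@arm_elt_long (true, a', k)).
exact: arm_relation.
Qed.

(** The three shapes are those of types A, D and E.  The loop of an arm of
    length [l] has nilpotency order [l + 1], and one of the three loops is minus
    the sum of the other two. *)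
Lemma loops_vanish_dynkin : [\/ n.-2 - b = 0,
  n.-2 - b = 1 | b = 2 /\ n.-2 - b <= 4]%N ->
  exists W, forall w : seq 'I_3,
    (W <= size w)%N -> \prod_(a <- w) loop O I a = 0.
Proof.
move=> shape; pose z (k : nat) (k3 : (k < 3)%N) := loop O I (Ordinal k3).
pose z0 := z 0%N isT; pose z1 := z 1%N isT; pose z2 := z 2%N isT.
have sum0 : z0 + z1 + z2 = 0.
  have := center_relation; rewrite !big_ord_recr big_ord0 /= add0r => rel0.
  by apply: etrans rel0; congr (_ + _ + _); congr (loop O I _); apply: val_inj.
have z0n : z0 ^+ 2 = 0 := loop_exp0 _.
have z1n : z1 ^+ b.+1 = 0 := loop_exp0 _.
have z2n : z2 ^+ (n.-2 - b).+1 = 0 := loop_exp0 _.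
have zP (a : 'I_3) : [\/ loop O I a = z0, loop O I a = z1 | loop O I a = z2].
  case: a => [[|[|[|//]]] k3]; [constructor 1|constructor 2|constructor 3];
    by congr (loop O I _); apply: val_inj.
have z2E : z2 = - (z0 + z1) by apply/eqP; rewrite -addr_eq0 addrC sum0.
have z1E : z1 = - (z0 + z2) by apply/eqP;
  rewrite -addr_eq0 addrA [z1 + _]addrC sum0.
have span01 m : (forall w, size w = m -> word z0 z1 w = 0) ->
    forall w : seq 'I_3, (m <= size w)%N -> \prod_(a <- w) loop O I a = 0.
  move=> wv w; apply: (words_vanish_span wv) => a.
  by case: (zP a) => ->; [left|right; left|right; right].
have span02 m : (forall w, size w = m -> word z0 z2 w = 0) ->
    forall w : seq 'I_3, (m <= size w)%N -> \prod_(a <- w) loop O I a = 0.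
  move=> wv w; apply: (words_vanish_span wv) => a.
  by case: (zP a) => ->; [left|right; right|right; left].
have expN (y : L) m : (- y) ^+ m = 0 -> y ^+ m = 0.
  by rewrite exprNn => y0; rewrite -(signrMK m (y ^+ m)) y0 mulr0.
have expW (y : L) m p : (m <= p)%N -> y ^+ m = 0 -> y ^+ p = 0.
  by move=> /subnKC <- y0; rewrite exprD y0 mul0r.
case: shape => [l0|l1|[b2 l4]].
- exists 2; apply/span01/words_vanish1 => //.
  by move: z2n; rewrite l0 expr1 z2E => /eqP; rewrite oppr_eq0 => /eqP.
- exists b.+2; apply/span02/words_vanish22 => //; first by move: z2n;
  rewrite l1.
  by apply: expN; rewrite -z1E.
- exists 15; apply/span01/words_vanish235 => //; first by move: z1n; rewrite b2.
  by apply: expN; rewrite -z2E; apply: expW z2n.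
Qed.

Lemma rho_walk v l : e v * \prod_(c <- l) rho c = 0 \/ walk v l.
Proof.
elim: l v => [|c l IH] v; first by right.
have -> : walk v (c :: l) = (src c == v) && walk (tgt c) l by [].
rewrite big_cons mulrA idem_rho eq_sym; case: eqP => _; last by left;
  rewrite mul0r.
case: (IH (tgt c)) => [H|->]; last by right.
have -> : rho c = rho c * e (tgt c) by rewrite rho_idem eqxx.
by left; rewrite -mulrA H mulr0.
Qed.

Lemma walk_moves v l : walk v l -> move_walk (pt v) (map mv l).
Proof.
elim: l v => // c l IH v.
have -> : walk v (c :: l) = (src c == v) && walk (tgt c) l by [].
case/andP=> /eqP <- /IH;
  rewrite /= (move_srcE bn adjE) (move_tgtE bn adjE) eqxx.
by [].
Qed.

Lemma signed_prod l : exists m : bool,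
  \prod_(c <- l) signed c = (-1) ^+ m * \prod_(c <- l) rho c.
Proof.
elim: l => [|c l [m IH]]; first by exists false; rewrite !big_nil mulr1.
exists (out_sign c (+) m); rewrite !big_cons IH signr_addb /signed -!mulrA.
by congr (_ * _); rewrite mulrA commr_sign -mulrA.
Qed.

Lemma star_nilpotent : [\/ n.-2 - b = 0,
  n.-2 - b = 1 | b = 2 /\ n.-2 - b <= 4]%N ->
  exists N, forall l : seq (arrow R), size l = N -> \prod_(c <- l) rho c = 0.
Proof.
move=> /loops_vanish_dynkin[W loops0]; have [v sv] := center_ex.
pose M := (\max_(a : 'I_3) len a)%N.
(* [M] bounds the lengths of the arms and [W] the length of nonzero words. *)
exists (3 * M + 2 * W + 1).+1%N => -[//|c l] sz.
have cl : \prod_(d <- c :: l) rho d = e (src c) * \prod_(d <- c :: l) rho d.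
  by rewrite big_cons mulrA idem_rho eqxx.
rewrite cl; have [//|/walk_moves walk_l] := rho_walk (src c) (c :: l).
have := @star_walks_vanish _ O I (e v) len _ _ _ _ _ W loops0 M _ _ _ walk_l.
rewrite size_map sz => H.
have {H} := H (fun a k => @arm_elt_long (true, a, k))
  (fun a k => @arm_elt_long (false, a, k))
  (fun a => arm_out_center a sv) (fun a => arm_in_center a sv) arm_relation
  (fun a => leq_bigmax a) (leqnn _).
rewrite big_map (eq_bigr signed) => [|d _]; last first.
  rewrite -arm_eltE; case: (mv d) => [[[] a] k] //.
have [m ->] := signed_prod (c :: l) => H.
by rewrite -[\prod_(d <- _) _](signrMK m) H !mulr0.
Qed.

End StarNilpotent.

(** * Vertex ideals of preprojective algebras *)

Section VertexIdealMembership.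
Variables (K : fieldType) (A : algebra K) (n : nat) (E : elementary A n).
Variables (i : 'I_n) (F : preproj_vertex E i).
Local Notation e := (idem E).

(** The arrows ending at [i] start elsewhere, so they lie in the ideal generated
    by [1 - e i]; together with [A * (1 - e i)] they generate the kernel of the
    augmentation. *)
Lemma vertex_ideal_mem x :
  (x \in principal_ideal (1 - e i)) = (aug E i x == 0).
Proof.
have mem1 : 1 - e i \in principal_ideal (1 - e i).
  by apply/asboolP; exists 1%N, (fun=> 1), (fun=> 1);
    rewrite big_ord1 mul1r mulr1.
apply/idP/eqP => [/asboolP[m [a [b ->]]]|x0].
  rewrite rmorph_sum big1 // => k _;
    rewrite !rmorphM rmorphB rmorph1 aug_idem eqxx.
  by rewrite subrr mulr0 mul0r.
have [||y xy] := inn_gen F (x := x * e i); first by rewrite -mulrA idemK.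
  by rewrite rmorphM x0 mul0r.
have -> : x = x * (1 - e i) + x * e i by rewrite -mulrDr subrK mulr1.
rewrite rpredD //; first exact: ideal_mull.
rewrite xy rpred_sum // => b _; apply: ideal_mull.
have -> : inn b = (1 - e i) * inn b.
  rewrite -(inn_l b) mulrA mulrBl mul1r idem_ortho ?subr0 ?mulrA ?idemK //.
  by rewrite eq_sym nbrv_neq.
exact: ideal_mulr.
Qed.

Lemma vertex_ideal_basic_tau_tilting :
  basic_ideal (principal_ideal (1 - e i)) /\
  support_tau_tilting_ideal (principal_ideal (1 - e i)).
Proof.
have memR (x : op A) : (x \in op_ideal (principal_ideal (1 - e i))) =
    (aug (op_elementary E) i x == 0) by exact: vertex_ideal_mem.
split; split.
- exact: (vertex_ideal_basic F vertex_ideal_mem).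
- exact: (vertex_ideal_basic (op_preproj_vertex F) memR).
- exact: (support_tau_tilting_vertex F vertex_ideal_mem).
- exact: (support_tau_tilting_vertex (op_preproj_vertex F) memR).
Qed.

End VertexIdealMembership.

Section PreprojMain.
Variables (K : fieldType) (n : nat) (Q : quiver 'I_n).
Local Notation R := (double_quiver Q).
Variables (KR : algebra K) (B : path_basis R KR).
Local Notation arr b := (pelt B (arrow_path (b : arrow R))).

Definition relation : KR :=
  \sum_(a : arrow Q) (arr (inl a) * arr (inr a) - arr (inr a) * arr (inl a)).

Lemma relationE :
  relation = \sum_(b : arrow R) (-1) ^+ is_star b * (arr b * arr (star b)).
Proof.
rewrite big_sumType /= -big_split; apply: eq_bigr => a _ /=.
by rewrite mulN1r mul1r.
Qed.

Local Notation "'L'" := (quotient_algebra (principal_ideal relation)).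
Local Notation pr := (quotient_map (principal_ideal relation)).

Lemma relation_src v :
  \sum_(c | src c == v)
    (-1) ^+ is_star c * (pr (arr c) * pr (arr (star c))) = 0 :> L.
Proof.
apply: etrans (etrans (congr1 ( *%R (pr (pelt B (trivial_path R v))))
  (pr_relation relationE)) (mulr0 _)).
rewrite mulr_sumr [LHS]big_mkcond; apply: eq_bigr => c _.
rewrite [RHS]mulrA commr_sign -[RHS]mulrA [pr (pelt B (trivial_path R v))
  * (_ * _)]mulrA idem_rho eq_sym.
by case: eqP; rewrite ?mul0r ?mulr0.
Qed.

Lemma preproj_ideal_basic_tau_tilting (i : 'I_n) : dynkin_quiver Q ->
  let e := pr (pelt B (trivial_path R i)) in
  basic_ideal (principal_ideal (1 - e : L)) /\
  support_tau_tilting_ideal (principal_ideal (1 - e : L)).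
Proof.
case=> t [s [size_n s_bij adjE]] e.
have [n1|n1] := leqP n 1.
  have e1 : 1 - e = 0.
    rewrite /e -(rmorph1 pr) (pelt1 B)
      (bigD1 i) //= big1 ?addr0 ?subrr // => j ji.
    by move: (ltn_ord i) (ltn_ord j) ji; rewrite -val_eqE /=; lia.
  have I0 (x : L) : x \in principal_ideal (1 - e) -> x = 0.
    by rewrite e1 principal0 => /eqP.
  have zl : zero_mod (ideal_module (principal_ideal (1 - e : L))).
    by move=> x; apply/val_inj/I0/(valP x).
  have zr : zero_mod (ideal_module (op_ideal (principal_ideal (1 - e : L)))).
    by move=> x; apply/val_inj/I0/(valP x).
  by split; split; [apply: basic_zero|apply: basic_zero|
    apply: support_tau_tilting_zero|apply: support_tau_tilting_zero].
have [b [bn adjb shape]] := dynkin_star size_n n1.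
have adjQ j k : num_edges Q j k = star_adj b n (s j) (s k).
  by rewrite adjE adjb.
have nil := star_nilpotent s_bij bn adjQ (rho_idem B relation)
  (idem_rho B relation) relation_src shape.
have [b0 b0i] := arrow_into s_bij bn adjQ i.
have loopless (c : arrow R) : src c = tgt c -> tgt c <> i.
  by move=> cE; case: (arrow_loopless bn adjQ cE).
exact: (vertex_ideal_basic_tau_tilting (preproj_vertex_at relationE nil
  loopless b0i)).
Qed.

End PreprojMain.

Theorem lemma2p3 (K : closedFieldType) (n : nat) (Q : quiver 'I_n)
    (hQ : dynkin_quiver Q) (i : 'I_n) :
  basic_ideal (vertex_ideal K Q i) /\
  support_tau_tilting_ideal (vertex_ideal K Q i).
Proof.
exact: (preproj_ideal_basic_tau_tilting (path_algebra_basis K (double_quiver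
  Q)) i hQ).
Qed.
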